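(* Let $(P,\pi)$ be a smooth (irreducible) rational quasi-affine Poisson variety over $\mathbb C$. Let $\mathcal C$ be a (generalized) cluster structure in $\mathbb C(P)$ that is regular on $P$ and compatible with $\pi$, and let $\overline{\rm Froz}$ be any regular $\pi$-compatible frozen variable modification of $\mathcal C$. For an extended cluster $\Phi$ of $\mathcal C$ let $\overline\Phi=(\Phi\setminus{\rm Froz})\sqcup\overline{\rm Froz}$. 1) For every extended cluster $\Phi$ of $\mathcal C$, the modification $\overline\Phi$ is again a log-canonical system on $(P,\pi)$, and the meromorphic form $\overline\mu_{\mathcal C}:=\mu_{\overline\Phi}$ on $P$ is, up to a sign, independent of the extended cluster $\Phi$ of $\mathcal C$. 2) Suppose that $p_0\in P$ is such that $\pi(p_0)=0$, and let $\pi_0$ be the linearization of $\pi$ at $p_0$. If the lowest degree term $(\overline\mu_{\mathcal C})^{\rm low}$ of $\overline\mu_{\mathcal C}$ at $p_0$ satisfies $\deg\big((\overline\mu_{\mathcal C})^{\rm low}\big)=\frac12{\rm rk}(\pi_0)$, then for every extended cluster $\Phi$ of $\mathcal C$ the log-canonical system $\overline\Phi$ has Property $\mathcal I$ at $p_0$, i.e. $\deg(\mu_{\overline\Phi}^{\rm low})=\frac12{\rm rk}(\pi_0)$, so the set $(\overline\Phi)^{\rm low}$ of lowest degree terms at $p_0$ of elements of $\overline\Phi$ contains a polynomial integrable system on $(T_{p_0}P,\pi_0)$.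
   Context: Let $n=\dim P$. $\mathbb C[P]$ and $\mathbb C(P)$ are the algebra of regular functions and the field of rational functions on $P$. Cluster structures. A seed in $\mathbb C(P)$ is a triple $(\Phi,{\rm ex},M)$ where $\Phi=(\varphi_1,\dots,\varphi_n)$ is a free transcendental basis of $\mathbb C(P)$ over $\mathbb C$, ${\rm ex}\subset[1,n]$, and $M=(m_{i,j})_{i\in[1,n],\,j\in{\rm ex}}$ is an integer matrix whose ${\rm ex}\times{\rm ex}$ submatrix is skew-symmetrizable. $\Phi$ is the extended cluster; $\varphi_j$ is a cluster variable if $j\in{\rm ex}$ and a frozen variable otherwise. The mutation in direction $k\in{\rm ex}$ replaces $\varphi_k$ by $$\varphi_k'=\frac{\prod_{m_{j,k}>0}\varphi_j^{m_{j,k}}+\prod_{m_{j,k}<0}\varphi_j^{-m_{j,k}}}{\varphi_k},$$ keeps the other $\varphi_j$, and replaces $M$ by $M'$ with $m'_{i,j}=-m_{i,j}$ if $i=k$ or $j=k$, and $m'_{i,j}=m_{i,j}+\frac12(|m_{i,k}|m_{k,j}+m_{i,k}|m_{k,j}|)$ otherwise. A cluster structure in $\mathbb C(P)$ is a mutation equivalence class of seeds. A generalized cluster structure is a class of seeds under the generalized mutation rule of Gekhtman–Shapiro–Vainshtein; a generalized mutation in direction $k\in{\rm ex}$ again changes only $\varphi_k$ to some $\varphi_k'$, and $\varphi_k\varphi_k'$ is a sum of possibly more than two monomials in $\Phi\setminus\{\varphi_k\}$ (this is the only feature needed). ${\rm Froz}$ denotes the common set of frozen variables of all seeds in $\mathcal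 C$. Functions are tuples or sets interchangeably. $\mathcal C$ is regular on $P$ if all cluster and frozen variables are in $\mathbb C[P]$, and compatible with $\pi$ if for every extended cluster $\Phi$ one has $\{\varphi,\psi\}_\pi\in\mathbb C\varphi\psi$ for all $\varphi,\psi\in\Phi$. A frozen variable modification of $\mathcal C$ is an algebraically independent subset $\overline{\rm Froz}$ of the subfield $\mathbb C({\rm Froz})$ generated by ${\rm Froz}$, with $|\overline{\rm Froz}|=|{\rm Froz}|$. It is regular if $\overline{\rm Froz}\subset\mathbb C[P]$, and $\pi$-compatible if each of its elements has the form $c\cdot M$ with $c\in\mathbb C(P)$ a Casimir function of $\pi$ and $M$ a monomial in ${\rm Froz}$. Log-canonical system on $(P,\pi)$: a set $\Phi=\{\varphi_1,\dots,\varphi_n\}$ of holomorphic functions with pairwise brackets $\{\varphi_i,\varphi_j\}_\pi\in\mathbb C\varphi_i\varphi_j$ and $d\varphi_1\wedge\cdots\wedge d\varphi_n\neq0$. Its log-volume form is $\mu_\Phi=\frac{d\varphi_1\wedge\cdots\wedge d\varphi_n}{\varphi_1\cdots\varphi_n}$ (defined up to sign, depending on ordering). Linearization. If $\pi(p_0)=0$, $\pi_0$ is the linear Poisson structure on $T_{p_0}P$ with $\{d_{p_0}\varphi,d_{p_0}\psi\}_{\pi_0}=d_{p_0}\{\varphi,\psi\}_\pi$. ${\rm rk}$ of a Poisson structure is the maximal rank over all points. Lowest degree terms at $p_0$. In local coordinates $z$ with $z(p_0)=0$ (also viewed as linear coordinates on $T_{p_0}P$), $\varphi^{\rm low}$ is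 the sum of the monomials of smallest total degree in the Taylor expansion of a non-zero $\varphi$, and its degree is that total degree. For a non-zero holomorphic $k$-form $\alpha$, $\alpha^{\rm low}$ keeps the monomials of smallest total degree $e$ occurring among all coefficients, and $\deg(\alpha^{\rm low})=e+k$. For a meromorphic form $\alpha=\alpha_1/\varphi$, $\alpha^{\rm low}=\alpha_1^{\rm low}/\varphi^{\rm low}$ and $\deg(\alpha^{\rm low})=\deg(\alpha_1^{\rm low})-\deg(\varphi^{\rm low})$. A polynomial integrable system on $(T_{p_0}P,\pi_0)$ is a set of $n-\frac12{\rm rk}(\pi_0)$ algebraically independent polynomials on $T_{p_0}P$ that pairwise Poisson commute with respect to $\pi_0$. *)

(* Defs.v *)
From HB Require Import structures.
From Stdlib Require Import Relation_Operators.
From mathcomp Require Import all_boot all_order all_algebra.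
From mathcomp Require Import reals complex mpoly.

Set Implicit Arguments.
Unset Strict Implicit.
Unset Printing Implicit Defensive.

Import Order.TTheory GRing.Theory Num.Theory.
Local Open Scope ring_scope.

Section Algebras.
Variables (C : fieldType) (A : comNzRingType) (scal : C -> A).

Definition alg_indep (I : finType) (f : I -> A) : Prop :=
  forall p : {mpoly C[#|I|]},
    mmap scal (fun i => f (enum_val i)) p = 0 -> p = 0.

Definition is_derivation (D : A -> A) : Prop :=
  [/\ forall a b, D (a + b) = D a + D b,
      forall c, D (scal c) = 0
    & forall a b, D (a * b) = D a * b + a * D b].

Definition is_poisson_bracket (br : A -> A -> A) : Prop :=
  [/\ forall a, is_derivation (br a),
      forall a b, br a b = - br b a
    & forall a b c, br a (br b c) + br b (br c a) + br c (br a b) = 0].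

End Algebras.

Section ZariskiTopology.
Variables (C : fieldType) (N : nat).
Implicit Types (S A B : ('I_N -> C) -> Prop).

Definition zero_locus (F : {mpoly C[N]} -> Prop) (p : 'I_N -> C) : Prop :=
  forall f, F f -> f.@[p] = 0.

Definition zariski_closed A : Prop :=
  exists F, forall p, A p <-> zero_locus F p.

Definition locally_closed S : Prop :=
  exists A B, [/\ zariski_closed A, zariski_closed B
                & forall p, S p <-> A p /\ ~ B p].

Definition zariski_irreducible S : Prop :=
  (exists p, S p) /\
  forall A B, zariski_closed A -> zariski_closed B ->
    (forall p, S p -> A p \/ B p) ->
    (forall p, S p -> A p) \/ (forall p, S p -> B p).

Definition vanishing_ideal S (f : {mpoly C[N]}) : Prop :=
  forall p, S p -> f.@[p] = 0.

End ZariskiTopology.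

(* An irreducible quasi-affine variety: an irreducible locally closed subset
   [pts] of affine space, together with its field of rational functions
   [ratfun], i.e. the field of fractions of the domain C[X_1..X_N] / I(pts);
   [coord j] is the class of X_j.  The last two fields determine [ratfun] up to
   a unique isomorphism. *)
Record variety (C : fieldType) := Variety {
  ambient : nat;
  pts : ('I_ambient -> C) -> Prop;
  pts_locally_closed : locally_closed pts;
  pts_irreducible : zariski_irreducible pts;
  ratfun : fieldType;
  scal : {rmorphism C -> ratfun};
  coord : 'I_ambient -> ratfun;
  coord_ker : forall f : {mpoly C[ambient]},
    mmap scal coord f = 0 <-> vanishing_ideal pts f;
  coord_gen : forall u : ratfun, exists a b : {mpoly C[ambient]},
    mmap scal coord b != 0 /\ u = mmap scal coord a / mmap scal coord b
}.

Section Variety.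
Variables (C : fieldType) (P : variety C).

Local Notation K := (ratfun P).
Local Notation sc := (scal P).
Local Notation point := ('I_(ambient P) -> C).

Definition in_gen_field (I : finType) (f : I -> K) (u : K) : Prop :=
  exists a b : {mpoly C[#|I|]},
    let ev := mmap sc (fun i => f (enum_val i)) in ev b != 0 /\ u = ev a / ev b.

Definition free_transcendental_basis (I : finType) (f : I -> K) : Prop :=
  alg_indep sc f /\ forall u, in_gen_field f u.

(* C(P) is purely transcendental of transcendence degree n; in particular
   n = dim P. *)
Definition rational_of_dim (n : nat) : Prop :=
  exists t : 'I_n -> K, free_transcendental_basis t.

(* Jacobian criterion at every point, for P of dimension n. *)
Definition smooth_of_dim (n : nat) : Prop :=
  forall p : point, pts p ->
    exists F : 'I_(ambient P - n) -> {mpoly C[ambient P]},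
      (forall i, vanishing_ideal (@pts C P) (F i)) /\
      \rank (\matrix_(i, j) ((F i)^`M(j)).@[p]) = (ambient P - n)%N.

Definition regular_at (p : point) (u : K) : Prop :=
  exists a b : {mpoly C[ambient P]},
    b.@[p] != 0 /\ u = mmap sc (@coord C P) a / mmap sc (@coord C P) b.

(* The maximal ideal m_p of the local ring O_p. *)
Definition max_ideal (p : point) (u : K) : Prop :=
  exists a b : {mpoly C[ambient P]},
    [/\ b.@[p] != 0, a.@[p] = 0
      & u = mmap sc (@coord C P) a / mmap sc (@coord C P) b].

Fixpoint max_ideal_pow (p : point) (d : nat) (u : K) : Prop :=
  if d is d'.+1 then
    exists (k : nat) (a b : 'I_k -> K),
      [/\ forall i, max_ideal p (a i), forall i, max_ideal_pow p d' (b i)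
        & u = \sum_(i < k) a i * b i]
  else regular_at p u.

(* The algebra C[P], as a subset of C(P). *)
Definition regular (u : K) : Prop := forall p, pts p -> regular_at p u.

(* A Poisson structure on the structure sheaf of P, given by its unique
   extension to a bracket on C(P). *)
Definition poisson_structure (br : K -> K -> K) : Prop :=
  is_poisson_bracket sc br /\
  forall p u v, pts p -> regular_at p u -> regular_at p v ->
    regular_at p (br u v).

Definition casimir (br : K -> K -> K) (c : K) : Prop := forall u, br c u = 0.

Record vector_field := VectorField {
  vf_fun :> K -> K;
  vf_derivation : is_derivation sc vf_fun
}.

(* Rational n-forms on P, as functions of n rational vector fields. *)
Definition rat_form (n : nat) : Type := ('I_n -> vector_field) -> K.

Definition wedge_d (n : nat) (phi : 'I_n -> K) : rat_form n :=
  fun D => \det (\matrix_(i, j) D i (phi j)).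

Definition log_volume (n : nat) (phi : 'I_n -> K) : rat_form n :=
  fun D => wedge_d phi D / \prod_i phi i.

Definition equal_up_to_sign (n : nat) (w w' : rat_form n) : Prop :=
  (forall D, w D = w' D) \/ (forall D, w D = - w' D).

(* Regular functions are holomorphic; conversely a rational function that is
   holomorphic on the smooth variety P is regular. *)
Definition log_canonical (br : K -> K -> K) (n : nat) (phi : 'I_n -> K) : Prop :=
  [/\ forall i, regular (phi i),
      forall i j, exists l : C, br (phi i) (phi j) = sc l * phi i * phi j
    & exists D, wedge_d phi D != 0].

End Variety.

Section Clusters.
Variables (C : fieldType) (P : variety C) (n : nat) (ex : {set 'I_n}).

Local Notation K := (ratfun P).
Local Notation sc := (scal P).
Local Notation mutable := {j : 'I_n | j \in ex}.
Local Notation frozen := {j : 'I_n | j \notin ex}.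

Record preseed := Preseed {
  ext_cluster : 'I_n -> K;
  exchange : 'I_n -> mutable -> int
}.

Definition skew_symmetrizable (M : mutable -> mutable -> int) : Prop :=
  exists d : mutable -> int, (forall i, 0 < d i) /\
    forall i j, d i * M i j = - (d j * M j i).

Definition is_seed (s : preseed) : Prop :=
  free_transcendental_basis (ext_cluster s) /\
  skew_symmetrizable (fun i j => exchange s (val i) j).

Definition mutate (k : mutable) (s : preseed) : preseed :=
  let phi := ext_cluster s in
  let m := exchange s in
  Preseed
    (fun j => if j == val k then
       (\prod_(i | 0 < m i k) phi i ^+ `|m i k|%N
        + \prod_(i | m i k < 0) phi i ^+ `|m i k|%N) / phi j
     else phi j)
    (fun i j => if (i == val k) || (j == k) then - m i j
     else m i j + ((`|m i k| * m (val k) j + m i k * `|m (val k) j|) %/ 2)%Z).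

Definition mutation_equivalent : preseed -> preseed -> Prop :=
  clos_refl_sym_trans preseed (fun s s' => exists k, s' = mutate k s).

(* A (generalized) cluster structure is handled through the set of extended
   clusters of its seeds, indexed so that ex is common to all of them. *)
Definition is_cluster_structure (CS : ('I_n -> K) -> Prop) : Prop :=
  exists s0, is_seed s0 /\
    forall phi, CS phi <->
      exists s, mutation_equivalent s0 s /\ ext_cluster s = phi.

Definition generalized_mutation (k : mutable) (phi phi' : 'I_n -> K) : Prop :=
  (forall j, j != val k -> phi' j = phi j) /\
  exists E : seq 'X_{1..n},
    [/\ (1 < size E)%N, all (fun e : 'X_{1..n} => e (val k) == 0%N) E
      & phi (val k) * phi' (val k) = \sum_(e <- E) mmap1 phi e].

(* The only features of the generalized mutation rule that are retained: each
   extended cluster can be mutated in every mutable direction, a mutation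
   changes one variable through an exchange relation with at least two
   monomials, and all extended clusters are linked by mutations. *)
Definition is_generalized_cluster_structure (CS : ('I_n -> K) -> Prop) : Prop :=
  [/\ exists phi, CS phi,
      forall phi, CS phi -> free_transcendental_basis phi,
      forall phi k, CS phi ->
        exists phi', CS phi' /\ generalized_mutation k phi phi'
    & forall phi phi', CS phi -> CS phi' ->
        clos_refl_sym_trans ('I_n -> K)
          (fun u v => [/\ CS u, CS v & exists k, generalized_mutation k u v])
          phi phi'].

Definition regular_structure (CS : ('I_n -> K) -> Prop) : Prop :=
  forall phi j, CS phi -> regular (phi j).

Definition compatible_structure (br : K -> K -> K) (CS : ('I_n -> K) -> Prop) :
    Prop :=
  forall phi i j, CS phi ->
    exists l : C, br (phi i) (phi j) = sc l * phi i * phi j.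

Definition are_frozen_variables (CS : ('I_n -> K) -> Prop) (Froz : frozen -> K) :
    Prop :=
  forall phi j, CS phi -> phi (val j) = Froz j.

Definition frozen_modification (Froz FrozBar : frozen -> K) : Prop :=
  alg_indep sc FrozBar /\ forall j, in_gen_field Froz (FrozBar j).

Definition poisson_compatible_modification (br : K -> K -> K)
    (Froz FrozBar : frozen -> K) : Prop :=
  forall j, exists (c : K) (e : frozen -> nat),
    casimir br c /\ FrozBar j = c * \prod_i Froz i ^+ e i.

(* The extended cluster phi with its frozen variables replaced by FrozBar. *)
Definition modify (FrozBar : frozen -> K) (phi : 'I_n -> K) : 'I_n -> K :=
  fun j => oapp FrozBar (phi j) (insub j).

End Clusters.

Section LocalStudy.
Variables (C : fieldType) (P : variety C) (n : nat).

Local Notation K := (ratfun P).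
Local Notation sc := (scal P).
Variable p : 'I_(ambient P) -> C.

(* Local coordinates vanishing at p, for P smooth of dimension n: a regular
   system of parameters of O_p, i.e. n generators of m_p. *)
Definition local_coordinates (z : 'I_n -> K) : Prop :=
  (forall i, max_ideal p (z i)) /\
  forall u, max_ideal p u ->
    exists a : 'I_n -> K,
      (forall i, regular_at p (a i)) /\ u = \sum_i a i * z i.

Variable z : 'I_n -> K.

(* The formal power series with coefficients c is the Taylor expansion of u in
   the coordinates z. *)
Definition taylor_expansion (u : K) (c : 'X_{1..n} -> C) : Prop :=
  forall d : nat,
    max_ideal_pow p d.+1 (u - \sum_(m : 'X_{1..n < d.+1}) sc (c m) * mmap1 z m).

(* q is the lowest degree term of u, and d its degree; z_i is viewed as the
   linear coordinate 'X_i on the tangent space at p. *)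
Definition lowest_term (u : K) (d : nat) (q : {mpoly C[n]}) : Prop :=
  exists c, [/\ taylor_expansion u c,
                forall m, (mdeg m < d)%N -> c m = 0,
                q = \sum_(m : 'X_{1..n < d.+1} | mdeg m == d) c m *: 'X_[m]
              & q != 0].

(* deg (w^low) = e for a meromorphic n-form w = (g dz_1 /\ .. /\ dz_n) / h. *)
Definition form_lowest_degree (w : rat_form P n) (e : int) : Prop :=
  exists (g h : K) (dg dh : nat) (qg qh : {mpoly C[n]}),
    [/\ regular_at p g /\ regular_at p h,
        forall D, w D = g * wedge_d z D / h,
        lowest_term g dg qg, lowest_term h dh qh
      & e = (dg + n)%N%:Z - dh%:Z].

(* deg (w^low) = r / 2; for w the log-volume form of a log-canonical system and
   r = rk(pi_0) this is Property I of the system at p. *)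
Definition form_degree_half (w : rat_form P n) (r : nat) : Prop :=
  exists e : int, form_lowest_degree w e /\ 2 * e = r%:Z.

Definition property_I (r : nat) (phi : 'I_n -> K) : Prop :=
  form_degree_half (log_volume phi) r.

(* d_p u is the linear polynomial \sum_i l_i 'X_i on the tangent space. *)
Definition differential (u : K) (l : {mpoly C[n]}) : Prop :=
  exists (c0 : C) (c : 'I_n -> C),
    l = \sum_i c i *: 'X_i /\
    max_ideal_pow p 2 (u - sc c0 - \sum_i sc (c i) * z i).

Definition vanishes_at (br : K -> K -> K) : Prop :=
  forall u v, regular_at p u -> regular_at p v -> max_ideal p (br u v).

Definition linearization (br : K -> K -> K)
    (br0 : {mpoly C[n]} -> {mpoly C[n]} -> {mpoly C[n]}) : Prop :=
  is_poisson_bracket (@mpolyC n C) br0 /\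
  forall u v l l' l'', regular_at p u -> regular_at p v ->
    differential u l -> differential v l' -> differential (br u v) l'' ->
    br0 l l' = l''.

End LocalStudy.

Section IntegrableSystems.
Variables (C : fieldType) (n : nat).
Variable br0 : {mpoly C[n]} -> {mpoly C[n]} -> {mpoly C[n]}.

Definition rank_at (v : 'I_n -> C) : nat :=
  \rank (\matrix_(i < n, j < n) (br0 'X_i 'X_j).@[v]).

Definition poisson_rank (r : nat) : Prop :=
  (exists v, rank_at v = r) /\ forall v, (rank_at v <= r)%N.

Definition polynomial_integrable_system (r : nat) (I : finType)
    (f : I -> {mpoly C[n]}) : Prop :=
  [/\ #|I| = (n - r./2)%N, alg_indep (@mpolyC n C) f
    & forall i j, br0 (f i) (f j) = 0].

End IntegrableSystems.

(* Main.v *)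
Require Import Defs.
From mathcomp Require Import all_boot all_order all_algebra.
From mathcomp Require Import reals complex mpoly.
From mathcomp Require Import perm boolp ring zify.

(** Both parts rest on computing with rational vector fields, that is with
    derivations of the function field K of P.

    Part 1.  Differentiating an exchange relation shows that a mutation changes the
    log-volume form of an extended cluster by the sign -1
    (log_volume_exchange), so this form is the same up to sign for all clusters
    (clusters_log_volume).  Replacing the frozen variables multiplies it by a
    function kappa that depends on the frozen variables only
    (log_volume_modify), so the same holds for the modified clusters.  The
    modified form is not zero because the frozen variables are algebraic over the
    modified ones: a vector field that annihilates the latter annihilates the former
    (deriv_frozen0).  Algebraicity comes from a count of monomials
    (algebraic_relation).  Brackets of modified variables are logarithmic by the
    Leibniz rule, Casimir functions being central (modify_log_pair).

    Part 2.  At a smooth point p, vector fields dual to given local coordinates z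
    exist that preserve the local ring (local_frame).  They show that the graded ring
    of the local ring is the polynomial ring in z (homog_pow_eq0), so leading forms
    are unique and multiplicative, and every non-zero regular function has one
    (krull_intersection).  Since the Poisson structure vanishes at p, the leading
    form of a bracket in the expected degree is the linearized bracket of the leading
    forms (lead_bracket); for a log-canonical pair the bracket has one order more,
    so the leading forms q_j of the modified cluster commute (lead_commute).

    It remains to find n - r / 2 independent forms among the q_j, of degrees d_j.
    Let k be the rank of their differentials.  The wedge product of the d phi_j has
    order at least (sum of the d_j) - k as a coefficient of dz
    (det_pow), so the degree of the log-volume form is at least n - k.  When this
    degree is r / 2, one gets k >= n - r / 2, and forms with independent
    differentials are algebraically independent (free_of_differentials). *)

Set Implicit Arguments.
Unset Strict Implicit.
Unset Printing Implicit Defensive.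

Import Order.TTheory GRing.Theory Num.Theory.
Local Open Scope ring_scope.

(** * Polynomial relations by counting monomials *)

Section Polynomials.
Variables (C : numFieldType) (k : nat).
Implicit Types (p q : {mpoly C[k]}).

(** Polynomials are generated by constants and variables.  Compared with induction
    on monomials, this form makes every statement that is stable under ring
    operations immediate. *)
Lemma mpoly_alg_ind (Q : {mpoly C[k]} -> Prop) :
  (forall c, Q c%:MP) -> (forall i, Q 'X_i) ->
  (forall p q, Q p -> Q q -> Q (p + q)) ->
  (forall p q, Q p -> Q q -> Q (p * q)) -> forall p, Q p.
Proof.
move=> QC QX QD QM; elim/mpolyind => [|c m p _ _ Qp].
  by rewrite -mpolyC0.
apply: (QD) => //; rewrite -mul_mpolyC; apply: (QM) => //.
rewrite mpolyXE_id; elim/big_rec: _ => [|i q _ Qq]; first by rewrite -mpolyC1.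
apply: (QM) => //; elim: (m i) => [|e IHe]; first by rewrite expr0 -mpolyC1.
by rewrite exprS; apply: (QM).
Qed.

(** Characteristic zero enters here: the coefficient of X^m in a partial derivative
    is a non-zero integer multiple of a coefficient of p. *)
Lemma mderiv_eq0_const p : (forall i, p^`M(i) = 0) -> p = (p@_0%MM)%:MP.
Proof.
move=> dp0; apply/mpolyP => m; rewrite mcoeffC.
have [->|m0] := eqVneq m 0%MM; first by rewrite mulr1.
have [i mi] : exists i, (0 < m i)%N.
  apply/existsP; apply: contraR m0; rewrite negb_exists => /forallP h.
  by apply/eqP/mnmP => i; rewrite mnm0E; move: (h i); rewrite lt0n negbK => /eqP.
have := congr1 (mcoeff (m - U_(i))%MM) (dp0 i).
rewrite mcoeff_mderiv mcoeff0 submK; last by rewrite lep1mP -lt0n.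
by move=> /eqP; rewrite mulrn_eq0 mulr0 eq_sym => /orP[/eqP //|/eqP].
Qed.

Lemma mderivXU (i j : 'I_k) : ('X_i : {mpoly C[k]})^`M(j) = (i == j)%:R.
Proof.
rewrite mderivX mnm1E; case: eqP => [->|_]; last by rewrite scale0r.
by rewrite -{1}[U_(j)%MM]add0m addmK mpolyX0 scale1r.
Qed.

Lemma msize_mderiv_lt p i : p != 0 -> (msize p^`M(i) < msize p)%N.
Proof.
move=> p0; rewrite -[X in (_ < X)%N]prednK ?lt0n ?msize_poly_eq0 // ltnS.
rewrite [X in (X <= _)%N]mmeasureE.
apply/bigmax_leqP_seq => m; rewrite mcoeff_msupp mcoeff_mderiv => nz _.
have : (m + U_(i))%MM \in msupp p.
  by rewrite mcoeff_msupp; apply: contraNneq nz => ->; rewrite mul0rn.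
by move/msize_mdeg_lt; rewrite mdegD mdeg1 addn1; case: (mmeasure mdeg p).
Qed.

Lemma msizeM_bound d e p q :
  (msize p <= d.+1)%N -> (msize q <= e.+1)%N -> (msize (p * q) <= (d + e).+1)%N.
Proof.
move=> pd qe; have [->|p0] := eqVneq p 0; first by rewrite mul0r msize0.
have [->|q0] := eqVneq q 0; first by rewrite mulr0 msize0.
rewrite msizeM //; move: (msize p) (msize q) pd qe => a b; lia.
Qed.

Lemma msizeX_bound d e p :
  (msize p <= d.+1)%N -> (msize (p ^+ e) <= (d * e).+1)%N.
Proof.
move=> pd; elim: e => [|e IHe]; first by rewrite expr0 msize1.
by rewrite exprS mulnS; apply: msizeM_bound.
Qed.

(** The exact count is a binomial coefficient; this crude polynomial bound of degree
    k in b is all that a comparison of growth rates requires. *)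
Lemma card_bmultinom b : (#|{: 'X_{1..k < b.+1}}| <= b.+1 ^ k)%N.
Proof.
rewrite -[X in (X ^ k)%N]card_ord -[k in (_ ^ k)%N]card_ord -card_ffun.
pose g (s : 'X_{1..k < b.+1}) := [ffun i => inord (s i) : 'I_b.+1].
apply: (leq_card g) => s s' /ffunP e.
have lt (x : 'X_{1..k < b.+1}) i : (x i < b.+1)%N.
  apply: leq_ltn_trans (bmdeg x); rewrite mdegE (bigD1 i) //=; exact: leq_addr.
apply/val_inj/mnmP => i; have := congr1 val (e i).
by rewrite !ffunE /= !inordK.
Qed.

End Polynomials.

Section Evaluation.
Variables (C : numFieldType) (K : fieldType) (sc : {rmorphism C -> K}).

(** The field generated by x over the constants, with the variables indexed by an
    ordinal rather than by the enumeration of a finite type. *)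
Definition in_frac k (x : 'I_k -> K) (u : K) : Prop :=
  exists a b : {mpoly C[k]}, mmap sc x b != 0 /\ u = mmap sc x a / mmap sc x b.

Lemma common_denominator (I : finType) k (x : 'I_k -> K) (f : I -> K) :
  (forall i, in_frac x (f i)) ->
  exists (a : I -> {mpoly C[k]}) (b : {mpoly C[k]}), mmap sc x b != 0 /\
    forall i, mmap sc x (a i) = f i * mmap sc x b.
Proof.
move=> fx; have [a h1] := choice fx; have [b h] := choice h1.
exists (fun i => a i * \prod_(j | j != i) b j), (\prod_j b j); split.
  by rewrite rmorph_prod; apply/prodf_neq0 => i _; case: (h i).
move=> i; rewrite (bigD1 (P := predT) i) //= !rmorphM /=.
by case: (h i) => bi ->; rewrite mulrA divfK.
Qed.

Lemma linear_relation (T S : finType) (Q : T -> S -> C) : (#|S| < #|T|)%N ->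
  exists c : T -> C, (exists t, c t != 0) /\ forall s, \sum_t c t * Q t s = 0.
Proof.
move=> ST; pose M := \matrix_(i < #|T|, j < #|S|) Q (enum_val i) (enum_val j).
have : kermx M != 0.
  rewrite -mxrank_eq0 mxrank_ker subn_eq0 -ltnNge.
  exact: leq_ltn_trans (rank_leq_col M) ST.
case/rowV0Pn => v /sub_kermxP vM v0.
exists (fun t => v 0 (enum_rank t)); split.
  have /existsP[j vj] : [exists j, v 0 j != 0].
    apply: contraR v0; rewrite negb_exists => /forallP h.
    by apply/eqP/rowP => j; rewrite mxE; move: (h j); rewrite negbK => /eqP.
  by exists (enum_val j); rewrite enum_valK.
move=> s; transitivity ((v *m M) 0 (enum_rank s)); last by rewrite vM mxE.
rewrite mxE (reindex (@enum_val T xpredT)) /=; last first.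
  by exists enum_rank => t _; [rewrite enum_valK | rewrite enum_rankK].
by apply: eq_bigr => i _; rewrite mxE enum_valK enum_rankK.
Qed.

(** The n + 1 elements f_1 .. f_n, u of a field generated by n elements satisfy a
    polynomial relation.  Write them with a common denominator b.  Among the
    m^(n+1) products of powers, with exponents below m, all become, once
    multiplied by a fixed power of b, polynomials of degree O(m) in t, hence live
    in a space of dimension O(m^n); for m large they are linearly dependent.  The
    relation is presented as a polynomial in u with coefficients polynomials in
    f, so that degree arguments in u can be made. *)
Lemma algebraic_relation n (t f : 'I_n -> K) (u : K) :
  (forall i, in_frac t (f i)) -> in_frac t u ->
  exists P : {poly {mpoly C[n]}}, P != 0 /\ (map_poly (mmap sc f) P).[u] = 0.
Proof.
move=> ft ut.
pose fu (i : option 'I_n) := oapp f u i.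
have fut i : in_frac t (fu i) by case: i.
have [a [b [b0 ab]]] := common_denominator fut.
pose d := (\max_i msize (a i) + msize b)%N.
have da i : (msize (a i) <= d.+1)%N.
  by apply/leqW/(leq_trans _ (leq_addr _ _))/leq_bigmax.
have db : (msize b <= d.+1)%N by apply/leqW/leq_addl.
(* d bounds all degrees and e is the power of b used to clear denominators, so the
   products have degree at most d * e < w * m; m > w ^ n makes m ^ (n + 1)
   exceed (w * m) ^ n. *)
pose w := (d * n.+1).+1; pose m := (w ^ n).+1; pose e := (n.+1 * m)%N.
pose T := ('I_m * {ffun 'I_n -> 'I_m})%type.
pose dg (tau : T) := (tau.1 + \sum_j tau.2 j)%N.
have dge tau : (dg tau <= e)%N.
  rewrite /dg /e mulSn leq_add ?(ltnW (ltn_ord _)) //.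
  rewrite -[X in (_ <= X * _)%N]card_ord -sum_nat_const.
  by apply: leq_sum => j _; apply/ltnW/ltn_ord.
pose Q (tau : T) : {mpoly C[n]} :=
  a None ^+ tau.1 * \prod_j a (Some j) ^+ tau.2 j * b ^+ (e - dg tau).
have Qsize tau : (msize (Q tau) <= (d * e).+1)%N.
  rewrite -(subnKC (dge tau)) mulnDr; apply: msizeM_bound; last exact: msizeX_bound.
  rewrite mulnDr; apply: msizeM_bound; first exact: msizeX_bound.
  elim/big_rec2: _ => [|j p q _ IH]; first by rewrite msize1.
  by rewrite mulnDr; apply: msizeM_bound => //; apply: msizeX_bound.
have Qev tau : mmap sc t (Q tau) =
    (u ^+ tau.1 * \prod_j f j ^+ tau.2 j) * mmap sc t b ^+ e.
  rewrite /Q !rmorphM !rmorphXn /= rmorph_prod /= ab exprMn.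
  rewrite (eq_bigr (fun j => f j ^+ tau.2 j * mmap sc t b ^+ tau.2 j)); last first.
    by move=> j _; rewrite rmorphXn /= ab exprMn.
  rewrite big_split /= prodrXr.
  have -> : mmap sc t b ^+ e = mmap sc t b ^+ tau.1 *
      mmap sc t b ^+ (\sum_j tau.2 j) * mmap sc t b ^+ (e - dg tau).
    by rewrite -!exprD subnKC ?dge.
  by rewrite !mulrA; congr (_ * _); rewrite -!mulrA; congr (_ * _); rewrite mulrCA.
have [|c [[[i0 al0] c0] hc]] := @linear_relation T 'X_{1..n < (d * e).+1}
    (fun tau s => (Q tau)@_s).
  apply: leq_ltn_trans (card_bmultinom _ _) _.
  rewrite card_prod card_ffun !card_ord.
  have le : ((d * e).+1 <= w * m)%N by rewrite /w /e; nia.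
  have le_exp : ((d * e).+1 ^ n <= (w * m) ^ n)%N.
    by elim: (n) => // j IHj; rewrite !expnS leq_mul.
  apply: leq_ltn_trans le_exp _.
  rewrite expnMn ltn_pmul2r //; by rewrite expn_gt0.
have rel : \sum_(tau : T) sc (c tau) * (u ^+ tau.1 * \prod_j f j ^+ tau.2 j) = 0.
  have : \sum_(tau : T) c tau *: Q tau = 0.
    apply/mpolyP => s; rewrite mcoeff0 raddf_sum /=.
    have [lt|ge] := ltnP (mdeg s) (d * e).+1.
      rewrite -[RHS](hc (BMultinom lt)); apply: eq_bigr => tau _.
      by rewrite mcoeffZ.
    rewrite big1 // => tau _; rewrite mcoeffZ memN_msupp_eq0 ?mulr0 //.
    by apply: msize_mdeg_ge; apply: leq_trans ge.
  move/(congr1 (mmap sc t)); rewrite raddf0 raddf_sum /=.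
  rewrite (eq_bigr (fun tau : T =>
      (sc (c tau) * (u ^+ tau.1 * \prod_j f j ^+ tau.2 j)) * mmap sc t b ^+ e)).
    rewrite -mulr_suml => /eqP; rewrite mulf_eq0 expf_eq0 (negPf b0) andbF orbF.
    by move/eqP.
  by move=> tau _; rewrite mmapZ Qev !mulrA.
pose mn (al : {ffun 'I_n -> 'I_m}) := [multinom (al j : nat) | j < n].
have mninj al : mn al = mn al0 -> al = al0.
  by move=> /mnmP h; apply/ffunP => j; apply/val_inj; have := h j; rewrite !mnmE.
pose Pc (i : 'I_m) := \sum_(al : {ffun 'I_n -> 'I_m}) c (i, al) *: 'X_[mn al].
exists (\sum_(i < m) Pc i *: 'X^i); split.
  apply/eqP => /(congr1 (fun P : {poly _} => P`_i0)).
  rewrite coef0 coef_sum (bigD1 i0) //= big1 => [|i ne]; last first.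
    rewrite coefZ coefXn; case: eqP => [e0|_]; last by rewrite mulr0.
    by move/eqP: ne; case; apply/val_inj.
  rewrite addr0 coefZ coefXn eqxx mulr1 => /(congr1 (mcoeff (mn al0))).
  rewrite mcoeff0 raddf_sum /= (bigD1 al0) //= big1 => [|al ne]; last first.
    rewrite mcoeffZ mcoeffX; case: eqP => [/mninj e0|_]; last by rewrite mulr0.
    by rewrite e0 eqxx in ne.
  by move/eqP; rewrite addr0 mcoeffZ mcoeffX eqxx mulr1; apply/negP.
rewrite rmorph_sum /= horner_sum -[RHS]rel.
transitivity (\sum_(i < m) \sum_(al : {ffun 'I_n -> 'I_m})
    sc (c (i, al)) * (u ^+ i * \prod_j f j ^+ al j)); last first.
  by rewrite pair_bigA /=; apply: eq_bigr => -[].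
apply: eq_bigr => i _.
rewrite linearZ /= rmorphXn /= map_polyX hornerZ hornerXn /Pc rmorph_sum /= mulr_suml.
apply: eq_bigr => al _; rewrite mmapZ mmapX /mmap1 mulrAC -mulrA; congr (_ * (_ * _)).
by apply: eq_bigr => j _; rewrite mnmE.
Qed.

End Evaluation.

(** * Derivations and algebraic independence *)

Section Derivations.
Variables (C : numFieldType) (A : comNzRingType) (sc : {rmorphism C -> A}).

Section OneDerivation.
Variables (D : A -> A) (derD : is_derivation sc D).

Lemma derivationD a b : D (a + b) = D a + D b.
Proof. by case: derD. Qed.

Lemma derivationC c : D (sc c) = 0.
Proof. by case: derD. Qed.

Lemma derivationM a b : D (a * b) = D a * b + a * D b.
Proof. by case: derD. Qed.

Lemma derivation0 : D 0 = 0.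
Proof. by rewrite -{1}(rmorph0 sc) derivationC. Qed.

Lemma derivationN a : D (- a) = - D a.
Proof. by apply/eqP; rewrite -addr_eq0 -derivationD addNr derivation0. Qed.

Lemma derivationB a b : D (a - b) = D a - D b.
Proof. by rewrite derivationD derivationN. Qed.

Lemma derivation_sum (I : Type) (r : seq I) (Q : pred I) (F : I -> A) :
  D (\sum_(i <- r | Q i) F i) = \sum_(i <- r | Q i) D (F i).
Proof. exact: (big_morph D derivationD derivation0). Qed.

Lemma derivation_mmap k (x : 'I_k -> A) (p : {mpoly C[k]}) :
  D (mmap sc x p) = \sum_j mmap sc x p^`M(j) * D (x j).
Proof.
elim/mpoly_alg_ind: p => [c|i|p q IHp IHq|p q IHp IHq].
- rewrite mmapC derivationC big1 // => j _; by rewrite mderivC raddf0 mul0r.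
- rewrite mmapX mmap1U (bigD1 i) //= big1 => [|j ji].
    by rewrite mderivXU eqxx rmorph1 mul1r addr0.
  by rewrite mderivXU eq_sym (negPf ji) rmorph0 mul0r.
- rewrite rmorphD derivationD IHp IHq -big_split; apply: eq_bigr => j _ /=.
  by rewrite mderivD raddfD mulrDl.
rewrite rmorphM derivationM IHp IHq mulr_suml mulr_sumr -big_split.
apply: eq_bigr => j _ /=; rewrite mderivM rmorphD !rmorphM /=; ring.
Qed.

End OneDerivation.

Lemma derivation_comb (I : finType) (a : I -> A) (D : I -> A -> A) :
  (forall i, is_derivation sc (D i)) ->
  is_derivation sc (fun u => \sum_i a i * D i u).
Proof.
move=> derD; split=> [u v|c|u v].
- by rewrite -big_split; apply: eq_bigr => i _; rewrite (derivationD (derD i)) mulrDr.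
- by rewrite big1 // => i _; rewrite (derivationC (derD i)) mulr0.
rewrite mulr_suml mulr_sumr -big_split; apply: eq_bigr => i _ /=.
rewrite (derivationM (derD i)); ring.
Qed.

End Derivations.

Section FieldDerivations.
Variables (C : numFieldType) (K : fieldType) (sc : {rmorphism C -> K}).

(** Algebraic independence, with the variables indexed by an ordinal. *)
Definition poly_free k (x : 'I_k -> K) : Prop :=
  forall p : {mpoly C[k]}, mmap sc x p = 0 -> p = 0.

Lemma derivation_div (D : K -> K) u v : is_derivation sc D -> v != 0 ->
  D (u / v) = (D u * v - u * D v) / v ^+ 2.
Proof.
move=> derD v0; have := derivationM derD (u / v) v; rewrite divfK // => ->.
by field.
Qed.

(** The quotient rule: the differential of a rational function of x is a combination
    of the differentials of x, with coefficients independent of the derivation. *)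
Lemma in_frac_differential k (x : 'I_k -> K) u : in_frac sc x u ->
  exists a : 'I_k -> K,
    forall D, is_derivation sc D -> D u = \sum_j a j * D (x j).
Proof.
case=> p [q [q0 ->]].
exists (fun j => (mmap sc x p^`M(j) * mmap sc x q
                  - mmap sc x p * mmap sc x q^`M(j)) / mmap sc x q ^+ 2).
move=> D derD; rewrite (derivation_div _ derD q0) !(derivation_mmap derD).
rewrite mulr_suml mulr_sumr -sumrB mulr_suml; apply: eq_bigr => j _; ring.
Qed.

Lemma deriv_in_frac0 k (x : 'I_k -> K) u D : is_derivation sc D ->
  in_frac sc x u -> (forall j, D (x j) = 0) -> D u = 0.
Proof.
move=> derD /in_frac_differential [a ->] // Dx; rewrite big1 // => j _.
by rewrite Dx mulr0.
Qed.

(** When x is a transcendence basis generating K, a derivation may be prescribed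
    freely on x.  Its value on a fraction a(x) / b(x) is forced by the quotient
    rule; algebraic independence makes it independent of the fraction. *)
Lemma derivation_exists k (x v : 'I_k -> K) :
  poly_free x -> (forall u, in_frac sc x u) ->
  exists D, is_derivation sc D /\ forall j, D (x j) = v j.
Proof.
move=> xfree xgen; pose ev := mmap sc x.
have [a h1] := choice xgen; have [b h] := choice h1.
have b0 u : ev (b u) != 0 by case: (h u).
have ab u : u = ev (a u) / ev (b u) by case: (h u).
pose d p := \sum_j ev p^`M(j) * v j.
have dD p q : d (p + q) = d p + d q.
  rewrite -big_split; apply: eq_bigr => j _ /=.
  by rewrite mderivD /ev rmorphD mulrDl.
have dM p q : d (p * q) = d p * ev q + ev p * d q.
  rewrite mulr_suml mulr_sumr -big_split; apply: eq_bigr => j _ /=.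
  rewrite mderivM /ev rmorphD !rmorphM /=; ring.
have dC c : d c%:MP = 0.
  by rewrite /d big1 // => j _; rewrite mderivC /ev raddf0 mul0r.
pose D u := (d (a u) * ev (b u) - ev (a u) * d (b u)) / ev (b u) ^+ 2.
have DE p q u : ev q != 0 -> u * ev q = ev p ->
    D u = (d p * ev q - ev p * d q) / ev q ^+ 2.
  move=> q0 uE; pose p' := a u; pose q' := b u.
  have E0 : ev p * ev q' = ev p' * ev q.
    rewrite -uE {1}(ab u) -/p' -/q' mulrAC divfK //; exact: b0.
  have E1 : d p * ev q' + ev p * d q' = d p' * ev q + ev p' * d q.
    rewrite -!dM; congr d; apply/eqP; rewrite -subr_eq0; apply/eqP/xfree.
    by rewrite rmorphB !rmorphM /= -/ev E0 subrr.
  rewrite /D -/p' -/q'; have q'0 : ev q' != 0 := b0 u.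
  apply/eqP; rewrite eqr_div ?expf_neq0 // -subr_eq0; apply/eqP.
  (* Both quotient rules agree because the relation p q' = p' q and its derivative
     hold. *)
  transitivity (ev q * ev q' * (d p' * ev q + ev p' * d q
                                - (d p * ev q' + ev p * d q'))
     + (ev q * d q' + ev q' * d q) * (ev p * ev q' - ev p' * ev q)); first by ring.
  by rewrite E0 E1 !subrr !mulr0 addr0.
have evC c : ev c%:MP = sc c by rewrite /ev mmapC.
have abE u : u * ev (b u) = ev (a u) by rewrite {1}(ab u) divfK.
exists D; split; first split.
- move=> s t; rewrite (@DE (a s * b t + a t * b s) (b s * b t) (s + t)).
  + rewrite dD !dM /D /ev rmorphD !rmorphM /= -/ev.
    by field; rewrite !b0.
  + by rewrite /ev rmorphM mulf_neq0 ?b0.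
  by rewrite /ev rmorphD !rmorphM /= -/ev -!abE; ring.
- move=> c; rewrite (@DE c%:MP 1%:MP) ?evC ?dC ?rmorph1 ?oner_neq0 ?mulr1 //.
  by rewrite mulr0 subrr mul0r.
- move=> s t; rewrite (@DE (a s * a t) (b s * b t) (s * t)).
  + rewrite !dM /D /ev !rmorphM /= -/ev -!abE.
    by field; rewrite !b0.
  + by rewrite /ev rmorphM mulf_neq0 ?b0.
  by rewrite /ev !rmorphM /= -/ev -!abE; ring.
move=> j; rewrite (@DE 'X_j 1%:MP) ?evC ?dC ?rmorph1 ?oner_neq0 ?mulr1 //; last first.
  by rewrite /ev mmapX mmap1U.
rewrite mulr0 subr0 expr1n divr1 /d (bigD1 j) //= big1 => [|i ij].
  by rewrite mderivXU eqxx /ev rmorph1 mul1r addr0.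
by rewrite mderivXU eq_sym (negPf ij) /ev rmorph0 mul0r.
Qed.

(** The easy half of the Jacobian criterion: differentiating a relation of minimal
    degree yields a linear relation between the differentials, whose coefficients
    are relations of smaller degree. *)
Lemma free_of_differentials k (x : 'I_k -> K) :
  (forall a : 'I_k -> K,
     (forall D, is_derivation sc D -> \sum_j a j * D (x j) = 0) ->
     forall j, a j = 0) ->
  poly_free x.
Proof.
move=> dx p; have [N] := ubnP (msize p); elim: N p => // N IHN p le_p xp.
have dp0 j : p^`M(j) = 0.
  have [->|p0] := eqVneq p 0; first by rewrite mderiv0.
  apply: IHN; first by apply: leq_trans (msize_mderiv_lt _ p0) _.
  move: j; apply: dx => D derD; rewrite -(derivation_mmap derD) xp; exact: derivation0 derD.
move: xp; rewrite [p](mderiv_eq0_const dp0) mmapC => /eqP.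
by rewrite fmorph_eq0 => /eqP ->.
Qed.

(** An element algebraic over f has no more derivations than f: differentiate a
    relation of minimal degree in u; its derivative in u does not vanish at u, by
    minimality and because the characteristic is zero. *)
Lemma deriv_algebraic0 k (f : 'I_k -> K) (P : {poly {mpoly C[k]}}) u D :
  is_derivation sc D -> poly_free f -> P != 0 ->
  (map_poly (mmap sc f) P).[u] = 0 -> (forall j, D (f j) = 0) -> D u = 0.
Proof.
move=> derD ffree + + Df; have [N] := ubnP (size P).
elim: N P => // N IHN P le_P P0 Pu.
pose e (Q : {poly {mpoly C[k]}}) := (map_poly (mmap sc f) Q).[u].
have De Q : D (e Q) = e Q^`() * D u.
  elim/poly_ind: Q => [|Q c IHQ].
    by rewrite poly.deriv0 /e rmorph0 horner0 (derivation0 derD) mul0r.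
  have eMXC (Q1 : {poly {mpoly C[k]}}) c1 : e (Q1 * 'X + c1%:P) = e Q1 * u + mmap sc f c1.
    by rewrite /e rmorphD rmorphM /= map_polyX map_polyC hornerMXaddC.
  rewrite eMXC (derivationD derD) (derivationM derD) IHQ (derivation_mmap derD f c).
  rewrite big1; last first.
    by move=> j _; rewrite Df mulr0.
  rewrite poly.derivD (poly.derivC c) addr0 poly.derivM derivX mulr1 addr0.
  by rewrite /e rmorphD rmorphM /= map_polyX hornerD hornerMX mulrDl mulrAC.
have P'u : e P^`() * D u = 0 by rewrite -De /e Pu (derivation0 derD).
have [P'0|P'0] := eqVneq P^`() 0; last first.
  move/eqP: P'u; rewrite mulf_eq0 => /orP[/eqP P'u|/eqP //].
  apply: (IHN P^`()) => //; rewrite ltnS in le_P; apply: leq_trans le_P.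
  exact: lt_size_deriv.
have PC : P = (P`_0)%:P.
  apply/polyP => -[|i]; rewrite coefC //=.
  have := congr1 (fun Q : {poly {mpoly C[k]}} => Q`_i) P'0.
  rewrite coef_deriv coef0 => Pi0; apply/mpolyP => m.
  have := congr1 (mcoeff m) Pi0; rewrite mcoeffMn mcoeff0.
  by move/eqP; rewrite mulrn_eq0 => /eqP.
move: P0 Pu; rewrite PC map_polyC hornerC => /negP P0 /ffree c0.
by case: P0; rewrite c0.
Qed.

End FieldDerivations.

(** * Renaming of variables and rational differential forms *)

Section Renaming.
Variables (C : numFieldType) (A : comNzRingType) (sc : {rmorphism C -> A}).

(** Substitution followed by evaluation, used with substitutions by variables to
    rename the index set of a family. *)
Lemma mmap_comp k l (x : 'I_l -> A) (h : 'I_k -> {mpoly C[l]}) (p : {mpoly C[k]}) :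
  mmap sc x (mmap (@mpolyC l C) h p) = mmap sc (fun i => mmap sc x (h i)) p.
Proof.
elim/mpoly_alg_ind: p => [c|i|p q IHp IHq|p q IHp IHq].
- by rewrite !mmapC.
- by rewrite !mmapX !mmap1U.
- by rewrite !rmorphD /= IHp IHq.
by rewrite !rmorphM /= IHp IHq.
Qed.

Lemma mmap_id k (p : {mpoly C[k]}) : mmap (@mpolyC k C) (fun i => 'X_i) p = p.
Proof.
elim/mpoly_alg_ind: p => [c|i|p q IHp IHq|p q IHp IHq].
- by rewrite mmapC.
- by rewrite mmapX mmap1U.
- by rewrite rmorphD /= IHp IHq.
by rewrite rmorphM /= IHp IHq.
Qed.

Lemma eq_mmap k (x y : 'I_k -> A) (p : {mpoly C[k]}) :
  x =1 y -> mmap sc x p = mmap sc y p.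
Proof. by move=> /funext ->. Qed.

Definition rename_ord k : {mpoly C[k]} -> {mpoly C[#|'I_k|]} :=
  mmap (@mpolyC _ C) (fun i => 'X_(enum_rank i)).

Definition unrename_ord k : {mpoly C[#|'I_k|]} -> {mpoly C[k]} :=
  mmap (@mpolyC _ C) (fun i => 'X_(enum_val i)).

Lemma mmap_rename_ord k (x : 'I_k -> A) p :
  mmap sc (fun i => x (enum_val i)) (rename_ord p) = mmap sc x p.
Proof.
by rewrite mmap_comp; apply: eq_mmap => i; rewrite mmapX mmap1U enum_rankK.
Qed.

Lemma mmap_unrename_ord k (x : 'I_k -> A) p :
  mmap sc x (unrename_ord p) = mmap sc (fun i => x (enum_val i)) p.
Proof. by rewrite mmap_comp; apply: eq_mmap => i; rewrite mmapX mmap1U. Qed.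

End Renaming.

Lemma rename_ordK (C : numFieldType) k : cancel (@rename_ord C k) (@unrename_ord C k).
Proof.
by move=> p; apply: etrans (mmap_rename_ord _ (fun i => 'X_i) p) (mmap_id p).
Qed.

Section RationalForms.
Variables (C : numFieldType) (P : variety C).
Local Notation K := (ratfun P).
Local Notation sc := (scal P).
Local Notation ev := (mmap sc).

Lemma alg_indep_ord n (f : 'I_n -> K) : alg_indep sc f -> poly_free sc f.
Proof.
move=> fi p fp; rewrite -[p]rename_ordK; suff -> : rename_ord p = 0 by exact: raddf0.
by apply: fi; rewrite mmap_rename_ord.
Qed.

Lemma in_gen_field_ord n (f : 'I_n -> K) u : in_gen_field f u -> in_frac sc f u.
Proof.
case=> a [b [b0 ->]]; exists (unrename_ord a), (unrename_ord b).
by rewrite !mmap_unrename_ord.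
Qed.

Lemma transcendental_basisP n (t : 'I_n -> K) : free_transcendental_basis t ->
  poly_free sc t /\ forall u, in_frac sc t u.
Proof.
by case=> ti tg; split=> [|u]; [apply: alg_indep_ord | apply: in_gen_field_ord].
Qed.

Lemma poly_free_neq0 n (f : 'I_n -> K) j : poly_free sc f -> f j != 0.
Proof.
move=> fi; apply/eqP => fj0; have : ('X_j : {mpoly C[n]}) = 0.
  by apply: fi; rewrite mmapX mmap1U.
by move/(congr1 (mcoeff U_(j)%MM))/eqP; rewrite mcoeffXU eqxx mcoeff0 oner_eq0.
Qed.

Lemma in_gen_field_differential (I : finType) (f : I -> K) u : in_gen_field f u ->
  exists a : I -> K, forall D : vector_field P, D u = \sum_i a i * D (f i).
Proof.
move=> /in_frac_differential [a Da]; exists (fun i => a (enum_rank i)) => D.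
rewrite (Da D (vf_derivation D)) (reindex (@enum_val I xpredT)) /=; last first.
  by exists enum_rank => t _; [rewrite enum_valK | rewrite enum_rankK].
by apply: eq_bigr => i _; rewrite enum_valK.
Qed.

Lemma dual_frame n (t : 'I_n -> K) : free_transcendental_basis t ->
  exists D : 'I_n -> vector_field P, forall i j, D i (t j) = (i == j)%:R.
Proof.
move=> /transcendental_basisP [tfree tgen].
have h i : exists D : vector_field P, forall j, D (t j) = (i == j)%:R.
  have [D [derD Dt]] := derivation_exists (fun j => (i == j)%:R) tfree tgen.
  by exists (VectorField derD).
by have [D Dt] := choice h; exists D.
Qed.

Lemma wedge_dual n (t : 'I_n -> K) (D : 'I_n -> vector_field P) :
  (forall i j, D i (t j) = (i == j)%:R) -> wedge_d t D = 1.
Proof.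
move=> Dt; rewrite /wedge_d -[RHS](det1 _ n); congr (\det _).
by apply/matrixP => i j; rewrite !mxE.
Qed.

Definition vf_comb n (a : 'I_n -> K) (D : 'I_n -> vector_field P) : vector_field P :=
  VectorField (derivation_comb a (fun i => vf_derivation (D i))).

(** A matrix is invertible when no non-zero combination of its rows, here of the
    vector fields, vanishes. *)
Lemma wedge_neq0P n (f : 'I_n -> K) (D : 'I_n -> vector_field P) :
  wedge_d f D != 0 <->
  (forall a : 'I_n -> K, (forall j, vf_comb a D (f j) = 0) -> forall i, a i = 0).
Proof.
rewrite /wedge_d -unitfE -unitmxE; set M := \matrix_(i, j) _.
have combE a j : vf_comb a D (f j) = ((\row_i a i) *m M) 0 j.
  by rewrite mxE; apply: eq_bigr => i _; rewrite !mxE.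
split=> [Mu a af i | h].
  suff /rowP/(_ i) : \row_i a i = 0 by rewrite !mxE.
  rewrite -[\row_i a i](mulmxK Mu).
  suff -> : (\row_i a i) *m M = 0 by rewrite mul0mx.
  by apply/rowP => j; rewrite -combE af mxE.
rewrite -row_free_unit -kermx_eq0; apply/eqP/row_matrixP => i; rewrite row0.
set v := row i _; have vM : v *m M = 0 by apply/sub_kermxP/row_sub.
apply/rowP => j; rewrite [RHS]mxE; apply: (h (fun j => v 0 j)) => l.
rewrite combE; suff -> : \row_i v 0 i = v by rewrite vM mxE.
by apply/rowP => s; rewrite mxE.
Qed.

Lemma wedge_poly_free n (f : 'I_n -> K) (D : 'I_n -> vector_field P) :
  wedge_d f D != 0 -> poly_free sc f.
Proof.
rewrite /wedge_d -unitfE -unitmxE; set M := \matrix_(i, j) _ => Mu.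
apply: free_of_differentials => a af j.
suff /colP/(_ j) : \col_i a i = 0 by rewrite !mxE.
rewrite -[\col_i a i](mulKmx Mu).
suff -> : M *m (\col_i a i) = 0 by rewrite mulmx0.
apply/colP => i; rewrite !mxE -[RHS](af _ (vf_derivation (D i))).
by apply: eq_bigr => l _; rewrite !mxE mulrC.
Qed.

Lemma equal_up_to_sign_refl n (w : rat_form P n) : equal_up_to_sign w w.
Proof. by left. Qed.

Lemma equal_up_to_sign_sym n (w w' : rat_form P n) :
  equal_up_to_sign w w' -> equal_up_to_sign w' w.
Proof. by case=> h; [left | right] => D; rewrite h ?opprK. Qed.

Lemma equal_up_to_sign_trans n (w w' w'' : rat_form P n) :
  equal_up_to_sign w w' -> equal_up_to_sign w' w'' -> equal_up_to_sign w w''.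
Proof.
by case=> h [] h'; [left|right|right|left] => D; rewrite h h' ?opprK.
Qed.

Lemma wedge_basechange n (f g : 'I_n -> K) (B : 'M[K]_n) :
  (forall (D : vector_field P) j, D (g j) = \sum_l D (f l) * B l j) ->
  forall D, wedge_d g D = wedge_d f D * \det B.
Proof.
move=> gB D; rewrite /wedge_d -det_mulmx; congr (\det _).
by apply/matrixP => i j; rewrite !mxE gB; apply: eq_bigr => l _; rewrite mxE.
Qed.

(** Differentiating the exchange relation gives
    d phi'_k = - (phi'_k / phi_k) d phi_k modulo the other d phi_j, because its
    right-hand side does not involve phi_k. *)
Lemma wedge_exchange n (phi phi' : 'I_n -> K) k (p : {mpoly C[n]}) :
  (forall j, j != k -> phi' j = phi j) -> phi k != 0 ->
  phi k * phi' k = ev phi p -> {in msupp p, forall m : 'X_{1..n}, m k = 0%N} ->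
  forall D, wedge_d phi' D = wedge_d phi D * - (phi' k / phi k).
Proof.
move=> agree phik0 ex pk.
have dkp : p^`M(k) = 0.
  apply/mpolyP => m; rewrite mcoeff_mderiv mcoeff0.
  rewrite memN_msupp_eq0 ?mul0rn //; apply/negP => /pk /eqP.
  by rewrite mnmDE mnm1E eqxx addn1.
pose B := \matrix_(l < n, j < n) if j == k
   then (if l == k then - (phi' k / phi k) else ev phi p^`M(l) / phi k)
   else (l == j)%:R.
move=> D; rewrite (@wedge_basechange _ phi phi' B) => [|{}D j]; last first.
  have [->|jk] := eqVneq j k; last first.
    rewrite agree // (bigD1 j) //= big1 => [|l lj].
      by rewrite mxE (negPf jk) eqxx mulr1 addr0.
    by rewrite mxE (negPf jk) (negPf lj) mulr0.
  have := derivationM (vf_derivation D) (phi k) (phi' k).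
  rewrite ex (derivation_mmap (vf_derivation D)) (bigD1 k) //= dkp raddf0 mul0r add0r.
  move=> e; apply: (mulfI phik0); rewrite (bigD1 k) //= mxE !eqxx mulrDr mulr_sumr.
  rewrite (eq_bigr (fun l => ev phi p^`M(l) * D (phi l))); last first.
    by move=> l lk; rewrite mxE eqxx (negPf lk); field.
  by rewrite e; field.
congr (_ * _); rewrite (expand_det_row _ k) (bigD1 k) //= big1 => [|j jk]; last first.
  by rewrite mxE (negPf jk) eq_sym (negPf jk) mul0r.
rewrite addr0 mxE !eqxx /cofactor addnn -signr_odd odd_double expr0 mul1r.
suff -> : row' k (col' k B) = 1%:M by rewrite det1 mulr1.
apply/matrixP => i j; rewrite !mxE eq_sym (negPf (neq_lift _ _)).
by rewrite (inj_eq lift_inj).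
Qed.

(** The factor of the previous lemma is exactly compensated, up to the sign, by the
    change of the product of the cluster. *)
Lemma log_volume_exchange n (phi phi' : 'I_n -> K) k (p : {mpoly C[n]}) :
  (forall j, j != k -> phi' j = phi j) -> phi k != 0 -> phi' k != 0 ->
  phi k * phi' k = ev phi p -> {in msupp p, forall m : 'X_{1..n}, m k = 0%N} ->
  equal_up_to_sign (log_volume phi) (log_volume phi').
Proof.
move=> agree phik0 phi'k0 ex pk; right => D; rewrite /log_volume.
rewrite (wedge_exchange agree phik0 ex pk).
rewrite (bigD1 k) //= [in RHS](bigD1 k) //=.
rewrite [in RHS](eq_bigr phi) => [|j jk]; last exact: agree.
rewrite mulrN mulNr opprK !invfM; move: (\prod_(_ | _) _)^-1 (wedge_d _ _) => r w.
by field; apply/andP.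
Qed.

End RationalForms.

(** * Log-volume forms of cluster structures *)

Section ExchangeMatrices.

(** The correction term of matrix mutation. *)
Definition half_product (a b : int) : int := ((`|a| * b + a * `|b|) %/ 2)%Z.

(** The division by 2 is exact, as |a|b + a|b| is 0 or twice a product.  Oddness of
    the correction term, hence involutivity of matrix mutation, follows. *)
Lemma half_productE a b : half_product a b * 2 = `|a| * b + a * `|b|.
Proof.
have [q qE] : exists q, `|a| * b + a * `|b| = q * 2.
  case: (ger0P a) => _; case: (ger0P b) => _.
  - by exists (a * b); ring.
  - by exists 0; ring.
  - by exists 0; ring.
  by exists (- (a * b)); ring.
by rewrite /half_product qE mulzK.
Qed.

Lemma half_productNN a b : half_product (- a) (- b) = - half_product a b.
Proof.
apply: (@mulIf _ (2 : int)) => //.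
by rewrite mulNr !half_productE !normrN mulrN mulNr opprD.
Qed.

End ExchangeMatrices.

Section Clusters.
Variables (C : numFieldType) (P : variety C) (n : nat) (ex : {set 'I_n}).
Local Notation K := (ratfun P).
Local Notation sc := (scal P).
Local Notation ev := (mmap sc).
Local Notation mutable := {j : 'I_n | j \in ex}.
Local Notation frozen := {j : 'I_n | j \notin ex}.
Local Notation seed := (preseed P ex).
Implicit Types (s : seed) (k : mutable).

Lemma exchange_mutate k s i j : exchange (mutate k s) i j =
  if (i == val k) || (j == k) then - exchange s i j
  else exchange s i j + half_product (exchange s i k) (exchange s (val k) j).
Proof. by []. Qed.

Lemma exchange_mutateK k s i j :
  exchange (mutate k (mutate k s)) i j = exchange s i j.
Proof.
rewrite !exchange_mutate !eqxx !orbT /=.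
have [_|_] := boolP ((i == val k) || (j == k)); first exact: opprK.
by rewrite half_productNN addrK.
Qed.

Definition skew_seed s := skew_symmetrizable (fun i j => exchange s (val i) j).

(** Hence the exchange relation in direction k does not involve the variable being
    replaced. *)
Lemma skew_seed_diag s k : skew_seed s -> exchange s (val k) k = 0.
Proof.
case=> d [d0 dm]; have := dm k k => /eqP; rewrite -addr_eq0 -mulr2n mulrn_eq0 /=.
by rewrite mulf_eq0 gt_eqF //= => /eqP.
Qed.

Lemma skew_seed_mutate k s : skew_seed s -> skew_seed (mutate k s).
Proof.
case=> d [d0 dm]; exists d; split=> // i j.
rewrite !exchange_mutate !val_eqE orbC [in RHS]orbC.
rewrite [in RHS]orbC; have [_|_] := boolP ((j == k) || (i == k)).
  by rewrite !mulrN dm.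
have dn a b : d a * `|exchange s (val a) b| = d b * `|exchange s (val b) a|.
  rewrite -[d a]ger0_norm ?ltW // -[d b]ger0_norm ?ltW // -!normrM dm normrN //.
rewrite !mulrDr dm opprD; congr (_ + _).
apply: (@mulIf _ (2 : int)) => //.
rewrite mulNr -!mulrA !half_productE !mulrDr !mulrA (dn i k) (dn j k) (dm i k) (dm j k).
rewrite mulNr [d k * _ * _]mulrAC.
ring.
Qed.

(** Both directions are needed: mutation equivalence is the equivalence closure of
    mutation, so that seeds are also reached by undoing a mutation. *)
Lemma skew_seed_mutateE k s : skew_seed (mutate k s) <-> skew_seed s.
Proof.
split=> [|/skew_seed_mutate]; last exact.
move/(@skew_seed_mutate k); case=> d [d0 dm]; exists d; split=> // i j.
by have := dm i j; rewrite !exchange_mutateK.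
Qed.

Definition exchange_mnm (neg : bool) (m : 'I_n -> int) : 'X_{1..n} :=
  [multinom if (if neg then m i < 0 else 0 < m i)%R then `|m i|%N else 0%N | i < n].

Lemma mmap_exchange_mnm neg m (phi : 'I_n -> K) :
  ev phi 'X_[exchange_mnm neg m] =
  \prod_(i | if neg then m i < 0 else 0 < m i) phi i ^+ `|m i|%N.
Proof.
rewrite mmapX [RHS]big_mkcond; apply: eq_bigr => i _; rewrite mnmE.
by case: ifP.
Qed.

Definition exchange_poly (m : 'I_n -> int) : {mpoly C[n]} :=
  'X_[exchange_mnm false m] + 'X_[exchange_mnm true m].

(** When both monomials are equal, their sum is 2 times a monomial, and not 0. *)
Lemma exchange_poly_neq0 m : exchange_poly m != 0.
Proof.
apply/eqP => /(congr1 (mcoeff (exchange_mnm false m))).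
rewrite mcoeffD !mcoeffX eqxx mcoeff0 -natrD.
by move/eqP; rewrite pnatr_eq0.
Qed.

Lemma exchange_poly_supp (m : 'I_n -> int) (k : 'I_n) : m k = 0 ->
  {in msupp (exchange_poly m), forall e : 'X_{1..n}, e k = 0%N}.
Proof.
move=> mk e /msuppD_le; rewrite mem_cat !msuppX !inE.
by case/orP => /eqP ->; rewrite mnmE mk ltxx.
Qed.

Lemma ext_cluster_mutate k s j : j != val k ->
  ext_cluster (mutate k s) j = ext_cluster s j.
Proof. by move=> /negPf /= ->. Qed.

Lemma ext_cluster_mutate_exchange k s : ext_cluster s (val k) != 0 ->
  ext_cluster s (val k) * ext_cluster (mutate k s) (val k)
  = ev (ext_cluster s) (exchange_poly (exchange s ^~ k)).
Proof.
move=> nz; rewrite /= eqxx mulrC divfK //.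
by rewrite rmorphD /= !mmap_exchange_mnm.
Qed.

Lemma wedge_neq0_of_log_volume m (phi psi : 'I_m -> K) (D : 'I_m -> vector_field P) :
  equal_up_to_sign (log_volume phi) (log_volume psi) ->
  log_volume phi D != 0 -> wedge_d psi D != 0.
Proof.
move=> e; have: (log_volume psi D == 0) = (log_volume phi D == 0).
  by case: e => ->; rewrite ?oppr_eq0.
by rewrite /log_volume mulf_eq0 => <-; rewrite negb_or => /andP[].
Qed.

(** The invariant carried along mutations.  The log-volume form itself keeps the
    cluster algebraically independent, since it is non-zero; this in turn makes the
    exchange polynomial, hence the new variable, non-zero. *)
Lemma mutation_log_volume s0 (D : 'I_n -> vector_field P) s s' :
  log_volume (ext_cluster s0) D != 0 ->
  mutation_equivalent s s' ->
  let good t := [/\ skew_seed t, forall j, ext_cluster t j != 0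
    & equal_up_to_sign (log_volume (ext_cluster s0)) (log_volume (ext_cluster t))] in
  good s <-> good s'.
Proof.
move=> nz + good; elim=> {s s'} [s s' [k ->]|//|s s' _ [] //|s1 s2 s3 _ h _ h'].
  split=> -[sk phi0 vol].
    have free := wedge_poly_free (wedge_neq0_of_log_volume vol nz).
    have rel := ext_cluster_mutate_exchange (phi0 (val k)).
    have phi'0 : ext_cluster (mutate k s) (val k) != 0.
      apply/eqP => e; move: rel; rewrite e mulr0 => /esym /free /eqP.
      by apply/negP/exchange_poly_neq0.
    split; first exact/skew_seed_mutateE.
      move=> j; have [->//|jk] := eqVneq j (val k).
      by rewrite ext_cluster_mutate.
    apply: equal_up_to_sign_trans vol _.
    apply: log_volume_exchange rel _ => //; first exact: ext_cluster_mutate.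
    apply/exchange_poly_supp/skew_seed_diag => //.
  have sk' := (skew_seed_mutateE k s).1 sk.
  have phi1 j : ext_cluster s j != 0.
    have [->|jk] := eqVneq j (val k); last by rewrite -(@ext_cluster_mutate k).
    have := phi0 (val k); rewrite /= eqxx; apply: contraNneq => ->.
    by rewrite invr0 mulr0.
  split=> //; apply: equal_up_to_sign_trans vol (equal_up_to_sign_sym _).
  apply: log_volume_exchange (ext_cluster_mutate_exchange _) _ => //.
    exact: ext_cluster_mutate.
  exact/exchange_poly_supp/skew_seed_diag.
by split=> [/h /h' | /h' /h].
Qed.

(** Both kinds of structures are reduced to the three facts used in the sequel.  In
    the generalized case every cluster is known to be a transcendental basis, so
    only the exchange relations matter. *)
Lemma clusters_log_volume (CS : ('I_n -> K) -> Prop) :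
  is_cluster_structure ex CS \/ is_generalized_cluster_structure ex CS ->
  [/\ forall phi, CS phi -> forall j, phi j != 0,
      forall phi psi, CS phi -> CS psi ->
        equal_up_to_sign (log_volume phi) (log_volume psi)
    & forall phi, CS phi -> exists D, wedge_d phi D != 0].
Proof.
move=> h; suff [phi0 [nz vol [D0 lv0]]] :
  exists phi0, [/\ forall phi, CS phi -> forall j, phi j != 0,
    forall phi, CS phi -> equal_up_to_sign (log_volume phi0) (log_volume phi)
    & exists D, log_volume phi0 D != 0].
  split=> // [phi psi /vol h1 /vol h2 | phi /vol h1].
    exact: equal_up_to_sign_trans (equal_up_to_sign_sym h1) h2.
  exists D0; exact: wedge_neq0_of_log_volume h1 lv0.
have basis_lv (phi : 'I_n -> K) : free_transcendental_basis phi ->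
    (forall j, phi j != 0) /\ exists D, log_volume phi D != 0.
  move=> phib; have [phifree _] := transcendental_basisP phib.
  have phi_nz j := poly_free_neq0 j phifree.
  split=> //; have [D Dphi] := dual_frame phib; exists D.
  rewrite /log_volume wedge_dual // mul1r invr_eq0.
  exact/prodf_neq0.
case: h => [[s0 [[s0b s0sk] CSP]] | [[phi0 CS0] CSb _ CSconn]].
  have [nz0 [D0 lv0]] := basis_lv _ s0b; exists (ext_cluster s0).
  have good phi : CS phi -> (forall j, phi j != 0) /\
      equal_up_to_sign (log_volume (ext_cluster s0)) (log_volume phi).
    case/CSP => s [/(mutation_log_volume lv0) [good _] <-].
    by case: good => //; split=> //; apply: equal_up_to_sign_refl.
  by split=> [phi /good []|phi /good []|] //; exists D0.
have [_ lv0] := basis_lv _ (CSb _ CS0); exists phi0; split=> //.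
  by move=> phi /CSb /basis_lv [].
move=> phi CSphi; have := CSconn _ _ CS0 CSphi.
elim=> {phi CSphi} [u v [CSu CSv [k [agree [E [_ Ek ex_uv]]]]]|u|u v _ h|u v w _ h _ h'].
- have [u0 _] := basis_lv _ (CSb _ CSu); have [v0 _] := basis_lv _ (CSb _ CSv).
  apply: (@log_volume_exchange _ _ _ _ _ (val k) (\sum_(e <- E) 'X_[e])) => //.
    by rewrite rmorph_sum ex_uv; apply: eq_bigr => e _; rewrite /= mmapX.
  move=> e; elim: E Ek {ex_uv} => [|e1 E IHE] /=; first by rewrite big_nil msupp0.
  case/andP => /eqP e1k Ek; rewrite big_cons => /msuppD_le; rewrite mem_cat msuppX inE.
  by case/orP => [/eqP -> //|]; apply: IHE.
- exact: equal_up_to_sign_refl.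
- exact: equal_up_to_sign_sym.
exact: equal_up_to_sign_trans h h'.
Qed.

End Clusters.

(** * Frozen variable modifications *)

Lemma sum_sig_insub (K : comNzRingType) (T : finType) (Q : pred T) (F : T -> K)
    (c : {x | Q x} -> K) :
  \sum_x F x * oapp c 0 (insub x) = \sum_(x : {x | Q x}) F (val x) * c x.
Proof.
rewrite (bigID Q) /= [X in _ + X]big1 ?addr0 => [|l Ql]; last first.
  by rewrite insubN ?mulr0.
rewrite (reindex_omap (fun l : {x | Q x} => val l) insub) => [|l Ql]; last first.
  by rewrite insubT.
by apply: eq_big => [l|l _]; rewrite valK //= eqxx andbT (valP l).
Qed.

Section Modification.
Variables (C : numFieldType) (P : variety C) (n : nat) (ex : {set 'I_n}).
Local Notation K := (ratfun P).
Local Notation sc := (scal P).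
Local Notation ev := (mmap sc).
Local Notation frozen := {j : 'I_n | j \notin ex}.

Lemma modify_frozen (FrozBar : frozen -> K) (phi : 'I_n -> K) (j : frozen) :
  modify FrozBar phi (val j) = FrozBar j.
Proof. by rewrite /modify valK. Qed.

Lemma modify_mutable (FrozBar : frozen -> K) (phi : 'I_n -> K) j :
  j \in ex -> modify FrozBar phi j = phi j.
Proof. by move=> jex; rewrite /modify insubN ?jex. Qed.

Lemma frozen_val j : j \notin ex -> exists j' : frozen, j = val j'.
Proof. by move=> jex; exists (exist _ j jex). Qed.

Lemma modify_ind (FrozBar : frozen -> K) (phi : 'I_n -> K) (Q : K -> Prop) :
  (forall j, j \in ex -> Q (phi j)) -> (forall j, Q (FrozBar j)) ->
  forall j, Q (modify FrozBar phi j).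
Proof.
move=> Qphi QF j; have [jex|jex] := boolP (j \in ex).
  by rewrite modify_mutable //; apply: Qphi.
by have [j' ->] := frozen_val jex; rewrite modify_frozen.
Qed.

Variables (Froz FrozBar : frozen -> K).
Hypothesis mod : frozen_modification Froz FrozBar.

(** The frozen variables are algebraic over their modification, since there are as
    many modified variables and they are algebraically independent in the field
    generated by the frozen ones. *)
Lemma deriv_frozen0 (D : vector_field P) :
  (forall j, D (FrozBar j) = 0) -> forall j, D (Froz j) = 0.
Proof.
case: mod => bar_free bar_gen D0 j.
have [Q [Q0 Qj]] : exists Q : {poly {mpoly C[#|{: frozen}|]}}, Q != 0 /\
    (map_poly (ev (fun i => FrozBar (enum_val i))) Q).[Froz j] = 0.
  apply: (@algebraic_relation _ _ sc _ (fun i => Froz (enum_val i))) => [i|].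
    exact: bar_gen.
  exists 'X_(enum_rank j), 1; rewrite !rmorph1 oner_neq0; split=> //.
  by rewrite mmapX mmap1U enum_rankK divr1.
by apply: deriv_algebraic0 Q0 Qj _ => //; apply: vf_derivation.
Qed.

(** A combination of the vector fields that annihilates the modified cluster
    annihilates the frozen variables, hence the original cluster. *)
Lemma wedge_modify_neq0 phi (D : 'I_n -> vector_field P) :
  (forall j : frozen, phi (val j) = Froz j) ->
  wedge_d phi D != 0 -> wedge_d (modify FrozBar phi) D != 0.
Proof.
move=> phiF /wedge_neq0P phiD; apply/wedge_neq0P => a a0; apply: phiD => j.
have [jex|jex] := boolP (j \in ex).
  by rewrite -(modify_mutable FrozBar) // a0.
have [j' ->] := frozen_val jex; rewrite phiF; apply: deriv_frozen0 => i.
by rewrite -(modify_frozen FrozBar phi).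
Qed.

(** The factor kappa comes from the Jacobian of FrozBar with respect to Froz and
    from the quotient of their products, so it is the same for all clusters with
    these frozen variables. *)
Lemma log_volume_modify : exists kappa : K, forall phi : 'I_n -> K,
  (forall j : frozen, phi (val j) = Froz j) -> (forall j, phi j != 0) ->
  forall D, log_volume (modify FrozBar phi) D = kappa * log_volume phi D.
Proof.
have [c Dc] := choice (fun j => in_gen_field_differential (mod.2 j)).
pose B := \matrix_(l < n, j < n)
  oapp (fun j' => oapp (c j') 0 (insub l)) (l == j)%:R (insub j).
exists (\det B * \prod_j oapp (fun j' => Froz j' / FrozBar j') 1 (insub j)).
move=> phi phiF phi0 D.
rewrite /log_volume (@wedge_basechange _ _ _ phi _ B) => [|{}D j]; last first.
  have [jex|jex] := boolP (j \in ex).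
    have jN : insub j = None :> option frozen by rewrite insubN ?jex.
    rewrite modify_mutable // (bigD1 j) //= big1 => [|l lj].
      by rewrite mxE jN /= eqxx mulr1 addr0.
    by rewrite mxE jN /= (negPf lj) mulr0.
  have [j' ->] := frozen_val jex; rewrite modify_frozen Dc.
  rewrite (eq_bigr (fun l => D (phi l) * oapp (c j') 0 (insub l))).
    by rewrite sum_sig_insub; apply: eq_bigr => l _; rewrite phiF mulrC.
  by move=> l _; rewrite mxE valK.
suff -> : (\prod_j modify FrozBar phi j)^-1 = (\prod_j oapp
    (fun j' : frozen => Froz j' / FrozBar j') 1 (insub j)) / \prod_j phi j by ring.
rewrite -!prodfV -big_split; apply: eq_bigr => j _ /=.
have [jex|jex] := boolP (j \in ex).
  by rewrite modify_mutable // insubN ?jex //= mul1r.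
have [j' ->] := frozen_val jex; rewrite modify_frozen valK /= phiF mulrAC mulfV ?mul1r //.
by rewrite -phiF phi0.
Qed.

End Modification.

Lemma bracket_derivation (C : fieldType) (A : comNzRingType) (sc : C -> A)
    (br : A -> A -> A) a : is_poisson_bracket sc br -> is_derivation sc (br a).
Proof. by case. Qed.

Section LogCanonical.
Variables (C : numFieldType) (P : variety C) (br : ratfun P -> ratfun P -> ratfun P).
Hypothesis brP : is_poisson_bracket (scal P) br.
Local Notation K := (ratfun P).
Local Notation sc := (scal P).

Lemma bracketC a b : br a b = - br b a.
Proof. by case: brP. Qed.

Definition log_pair (u v : K) := exists l : C, br u v = sc l * u * v.

Lemma log_pairC u v : log_pair u v -> log_pair v u.
Proof.
by case=> l h; exists (- l); rewrite bracketC h rmorphN !mulNr mulrAC.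
Qed.

Lemma log_pairM u v w : log_pair u v -> log_pair u w -> log_pair u (v * w).
Proof.
case=> l hv [m hw]; exists (l + m).
rewrite (derivationM (bracket_derivation u brP)) hv hw rmorphD; ring.
Qed.

Lemma log_pair1 u : log_pair u 1.
Proof.
by exists 0; rewrite -(rmorph1 sc) (derivationC (bracket_derivation u brP)) rmorph0 !mul0r.
Qed.

Lemma log_pair_casimir u c : casimir br c -> log_pair u c.
Proof. by move=> cas; exists 0; rewrite bracketC cas oppr0 rmorph0 !mul0r. Qed.

Lemma log_pair_monomial u (I : finType) (f : I -> K) (e : I -> nat) :
  (forall i, log_pair u (f i)) -> log_pair u (\prod_i f i ^+ e i).
Proof.
move=> uf; elim/big_rec: _ => [|i v _ uv]; first exact: log_pair1.
apply: log_pairM uv; elim: (e i) => [|m IHm]; first exact: log_pair1.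
by rewrite exprS; apply: log_pairM.
Qed.

Lemma modify_log_pair n (ex : {set 'I_n}) (phi : 'I_n -> K) (Froz FrozBar : _ -> K) :
  (forall j : {j : 'I_n | j \notin ex}, phi (val j) = Froz j) ->
  (forall i j, log_pair (phi i) (phi j)) ->
  poisson_compatible_modification br Froz FrozBar ->
  forall i j, log_pair (modify FrozBar phi i) (modify FrozBar phi j).
Proof.
move=> phiF phiL bar; have barL u : (forall j, log_pair u (phi j)) ->
    forall j, log_pair u (FrozBar j).
  move=> uphi j; have [c [e [cas ->]]] := bar j.
  apply: log_pairM; first exact: log_pair_casimir.
  by apply: log_pair_monomial => i; rewrite -phiF.
have step u : (forall j, log_pair u (phi j)) ->
    forall j, log_pair u (modify FrozBar phi j).
  by move=> uphi; apply: (modify_ind (Q := log_pair u)) => // j; apply: barL.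
move=> i; apply: (step) => j; apply: log_pairC; move: i.
by apply: (step) => i.
Qed.

End LogCanonical.

(** * The local ring at a point and frames of vector fields *)

(** A left inverse of the square matrix obtained by completing G with rows F2, split
    into two blocks; splitting avoids a cast between N and m + n. *)
Lemma row_free_complement (C : fieldType) N m n (G : 'M[C]_(m, N)) :
  N = (m + n)%N -> row_free G ->
  exists (E : 'M[C]_(N, m)) (F1 : 'M[C]_(N, n)) (F2 : 'M[C]_(n, N)),
    E *m G + F1 *m F2 = 1%:M.
Proof.
move=> eN; rewrite {}eN in G * => Gfree; pose U := row_ebase G; pose L := col_ebase G.
have GE : G = L *m usubmx U.
  rewrite -[G in LHS]mulmx_ebase -/U -/L -mulmxA; congr (_ *m _).
  have -> : \rank G = m by apply/eqP.
  by rewrite -[U in LHS]vsubmxK pid_mx_row mul_row_col mul1mx mul0mx addr0.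
have Lu : L \in unitmx := col_ebase_unit G.
have Uu : U \in unitmx := row_ebase_unit G.
exists (lsubmx (invmx U) *m invmx L), (rsubmx (invmx U)), (dsubmx U).
rewrite GE mulmxA mulmxKV // -[RHS](mulVmx Uu).
by rewrite -mul_row_col hsubmxK vsubmxK.
Qed.

Section LocalRing.
Variables (C : numFieldType) (P : variety C) (p : 'I_(ambient P) -> C).
Hypothesis Pp : pts p.
Local Notation K := (ratfun P).
Local Notation sc := (scal P).
Local Notation coord := (@Defs.coord C P).
Local Notation ev := (mmap (scal P) coord).

(** The residue map of the local ring, as a relation: it is meaningful only for
    regular functions, and single-valued at the points of P. *)
Definition has_value (u : K) (c : C) : Prop :=
  exists a b : {mpoly C[ambient P]},
    [/\ b.@[p] != 0, a.@[p] = c * b.@[p] & u = ev a / ev b].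

Lemma coord_eval_neq0 b : b.@[p] != 0 -> ev b != 0.
Proof. by apply: contraNneq => /coord_ker /(_ _ Pp) ->. Qed.

Lemma regular_atP u : regular_at p u <-> exists c, has_value u c.
Proof.
split=> [[a [b [b0 ->]]] | [c [a [b [b0 _ ->]]]]]; last by exists a, b.
by exists (a.@[p] / b.@[p]), a, b; rewrite divfK.
Qed.

Lemma max_idealP u : max_ideal p u <-> has_value u 0.
Proof.
split=> [[a [b [b0 a0 ->]]] | [a [b [b0 a0 ->]]]].
  by exists a, b; rewrite mul0r.
by exists a, b; rewrite a0 mul0r.
Qed.

Lemma value_regular u c : has_value u c -> regular_at p u.
Proof. by move=> uc; apply/regular_atP; exists c. Qed.

Lemma value_unique u c d : has_value u c -> has_value u d -> c = d.
Proof.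
case=> a [b [b0 ac ->]] [a' [b' [b'0 a'd]]] /eqP.
rewrite eqr_div ?coord_eval_neq0 // -!rmorphM -subr_eq0 -rmorphB /=.
move=> /eqP /coord_ker /(_ _ Pp) /eqP; rewrite rmorphB !rmorphM /= ac a'd subr_eq0.
by rewrite -!mulrA [b.@[p] * _]mulrC => /eqP /mulIf; apply; rewrite mulf_neq0.
Qed.

Lemma value_poly a : has_value (ev a) a.@[p].
Proof. by exists a, 1; rewrite !rmorph1 oner_neq0 mulr1 divr1. Qed.

Lemma value_const c : has_value (sc c) c.
Proof. by have := value_poly c%:MP; rewrite mmapC mevalC. Qed.

Lemma value_coord j : has_value (coord j) (p j).
Proof. by have := value_poly 'X_j; rewrite mmapX mmap1U mevalXU. Qed.

Lemma valueD u v c d : has_value u c -> has_value v d -> has_value (u + v) (c + d).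
Proof.
case=> a [b [b0 ac ->]] [a' [b' [b'0 a'd ->]]].
exists (a * b' + a' * b), (b * b'); split.
- by rewrite rmorphM mulf_neq0.
- by rewrite rmorphD !rmorphM /= ac a'd; ring.
by rewrite rmorphD !rmorphM /=; field; rewrite !coord_eval_neq0.
Qed.

Lemma valueM u v c d : has_value u c -> has_value v d -> has_value (u * v) (c * d).
Proof.
case=> a [b [b0 ac ->]] [a' [b' [b'0 a'd ->]]].
exists (a * a'), (b * b'); split.
- by rewrite rmorphM mulf_neq0.
- by rewrite !rmorphM /= ac a'd; ring.
by rewrite !rmorphM /=; field; rewrite !coord_eval_neq0.
Qed.

Lemma valueN u c : has_value u c -> has_value (- u) (- c).
Proof.
move=> uc; rewrite -(mulN1r u) -(mulN1r c); apply: valueM => //.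
by have := value_const (-1); rewrite rmorphN1.
Qed.

Lemma valueB u v c d : has_value u c -> has_value v d -> has_value (u - v) (c - d).
Proof. by move=> uc vd; apply: valueD => //; apply: valueN. Qed.

Lemma valueV u c : c != 0 -> has_value u c -> has_value u^-1 c^-1.
Proof.
move=> c0 [a [b [b0 ac ->]]]; exists b, a; rewrite ac mulf_neq0 //; split=> //.
  by rewrite mulKf.
by rewrite invfM invrK mulrC.
Qed.

Lemma value0 : has_value 0 0.
Proof. by rewrite -(rmorph0 sc); apply: value_const. Qed.

Lemma value1 : has_value 1 1.
Proof. by have := value_const 1; rewrite rmorph1. Qed.

Lemma value_sum (I : Type) (r : seq I) (Q : pred I) (u : I -> K) (c : I -> C) :
  (forall i, has_value (u i) (c i)) ->
  has_value (\sum_(i <- r | Q i) u i) (\sum_(i <- r | Q i) c i).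
Proof.
by move=> uc; elim/big_rec2: _ => [|i d v _ vd]; [apply: value0 | apply: valueD].
Qed.

Lemma value_prod (I : Type) (r : seq I) (Q : pred I) (u : I -> K) (c : I -> C) :
  (forall i, has_value (u i) (c i)) ->
  has_value (\prod_(i <- r | Q i) u i) (\prod_(i <- r | Q i) c i).
Proof.
by move=> uc; elim/big_rec2: _ => [|i d v _ vd]; [apply: value1 | apply: valueM].
Qed.

Lemma value_sign b : has_value ((-1) ^+ b) ((-1) ^+ b).
Proof.
elim: b => [|b IHb]; first by rewrite !expr0; apply: value1.
by rewrite !exprS; apply: valueM => //; apply/valueN/value1.
Qed.

Lemma value_mulmx m k l (A : 'M[K]_(m, k)) (B : 'M[K]_(k, l))
    (Ap : 'M[C]_(m, k)) (Bp : 'M[C]_(k, l)) :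
  (forall i j, has_value (A i j) (Ap i j)) ->
  (forall i j, has_value (B i j) (Bp i j)) ->
  forall i j, has_value ((A *m B) i j) ((Ap *m Bp) i j).
Proof. by move=> vA vB i j; rewrite !mxE; apply: value_sum => s; apply: valueM. Qed.

Lemma value_det m (A : 'M[K]_m) (Ap : 'M[C]_m) :
  (forall i j, has_value (A i j) (Ap i j)) -> has_value (\det A) (\det Ap).
Proof.
move=> vA; apply: value_sum => s; apply: valueM; first exact: value_sign.
by apply: value_prod => i.
Qed.

Lemma regular_at_sum (I : Type) (r : seq I) (Q : pred I) (u : I -> K) :
  (forall i, regular_at p (u i)) -> regular_at p (\sum_(i <- r | Q i) u i).
Proof.
move=> uc; have [c h] := choice (fun i => (regular_atP (u i)).1 (uc i)).
exact: value_regular (value_sum r Q h).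
Qed.

Lemma regular_atD u v : regular_at p u -> regular_at p v -> regular_at p (u + v).
Proof.
by move=> /regular_atP [c uc] /regular_atP [d vd]; apply: value_regular (valueD uc vd).
Qed.

Lemma regular_atM u v : regular_at p u -> regular_at p v -> regular_at p (u * v).
Proof.
by move=> /regular_atP [c uc] /regular_atP [d vd]; apply: value_regular (valueM uc vd).
Qed.

Lemma regular_atN u : regular_at p u -> regular_at p (- u).
Proof. by move=> /regular_atP [c uc]; apply: value_regular (valueN uc). Qed.

(** Cramer's rule: the determinant is a unit of the local ring, since its value is
    non-zero. *)
Lemma regular_invmx m (A : 'M[K]_m) (Ap : 'M[C]_m) :
  (forall i j, has_value (A i j) (Ap i j)) -> Ap \in unitmx ->
  A \in unitmx /\ forall i j, regular_at p (invmx A i j).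
Proof.
move=> vA; rewrite unitmxE unitfE => Ap0; have vdet := value_det vA.
have Au : A \in unitmx.
  rewrite unitmxE unitfE; apply: contraNneq Ap0 => dA0.
  by rewrite (value_unique vdet (_ : has_value _ 0)) // dA0; apply: value0.
split=> // i j; rewrite /invmx Au !mxE; apply: regular_atM.
  exact: value_regular (valueV Ap0 vdet).
apply: regular_atM; first exact: value_regular (value_sign _).
apply: (@value_regular _ (\det (row' j (col' i Ap)))); apply: value_det => s t.
by rewrite !mxE; apply: vA.
Qed.

Definition preserves_regular (D : K -> K) : Prop :=
  forall u, regular_at p u -> regular_at p (D u).

Lemma preserves_regular_coord (D : vector_field P) :
  (forall j, regular_at p (D (coord j))) -> preserves_regular D.
Proof.
move=> Dx; have Dev a : regular_at p (D (ev a)).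
  rewrite (derivation_mmap (vf_derivation D)); apply: regular_at_sum => j.
  by apply: regular_atM => //; apply: value_regular (value_poly _).
have evr a : regular_at p (ev a) by apply: value_regular (value_poly _).
move=> _ [a [b [b0 ->]]]; rewrite (derivation_div _ (vf_derivation D)); last first.
  exact: coord_eval_neq0.
apply: regular_atM; first by apply: regular_atD; [|apply: regular_atN]; apply: regular_atM.
by apply: value_regular (valueV _ (valueM (value_poly b) (value_poly b))); rewrite mulf_neq0.
Qed.

Lemma preserves_regular_comb n (a : 'I_n -> K) (D : 'I_n -> vector_field P) :
  (forall i, regular_at p (a i)) -> (forall i, preserves_regular (D i)) ->
  preserves_regular (vf_comb a D).
Proof.
by move=> ar Dr u ur; apply: regular_at_sum => i; apply: regular_atM => //; apply: Dr.
Qed.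

(** The Jacobian matrix G of some equations F of P has full rank at p, so that
    constant matrices complete it into H = E G + F1 F2 whose value at p is the
    identity; H is thus invertible over the local ring.  The matrix W
    of a basis of derivations satisfies W G^T = 0, so W H^T only depends on
    W F2^T, and after the base change that turns W F2^T into the identity the
    derivations map the coordinates to entries of F1^T H^-T, which are regular. *)
Lemma smooth_frame n : rational_of_dim P n -> smooth_of_dim P n ->
  exists (y : 'I_n -> K) (D : 'I_n -> vector_field P),
    [/\ forall i, max_ideal p (y i), forall i, preserves_regular (D i)
      & forall i j, D i (y j) = (i == j)%:R].
Proof.
move=> [t tb] /(_ p Pp) [F [FI Frank]].
have [d dt] := dual_frame tb.
pose N := ambient P; pose m := (N - n)%N.
pose W := \matrix_(i < n, j < N) d i (coord j).
have combW (a : 'rV[K]_n) j : vf_comb (a 0) d (coord j) = (a *m W) 0 j.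
  by rewrite mxE; apply: eq_bigr => i _; rewrite !mxE.
have W0 (a : 'rV[K]_n) : a *m W = 0 -> a = 0.
  move=> aW; apply/rowP => i; rewrite mxE.
  have D0 u : vf_comb (a 0) d u = 0.
    apply: (deriv_in_frac0 (vf_derivation _) (coord_gen u)) => j.
    by rewrite combW aW mxE.
  rewrite -[RHS](D0 (t i)) /= (bigD1 i) //= big1 => [|l li].
    by rewrite dt eqxx mulr1 addr0.
  by rewrite dt (negPf li) mulr0.
(* The truncated subtraction in the smoothness hypothesis is a true one, because the
   n independent derivations are determined by their values on the N coordinates. *)
have nN : (n <= N)%N.
  have : row_free W.
    rewrite -kermx_eq0; apply/eqP/row_matrixP => i; rewrite row0.
    by apply: W0; apply/sub_kermxP/row_sub.
  by rewrite /row_free => /eqP <-; apply: rank_leq_col.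
pose Gp := \matrix_(i < m, j < N) (F i)^`M(j).@[p].
pose G := \matrix_(i < m, j < N) ev (F i)^`M(j).
have WG : W *m G^T = 0.
  apply/matrixP => i j; rewrite mxE [RHS]mxE; transitivity (d i (ev (F j))).
    rewrite (derivation_mmap (vf_derivation (d i))).
    by apply: eq_bigr => l _; rewrite !mxE mulrC.
  by rewrite (coord_ker (F j)).2 //; apply/derivation0/vf_derivation.
have [E [F1 [F2 EF]]] : exists (E : 'M[C]_(N, m)) (F1 : 'M[C]_(N, n)) (F2 : 'M[C]_(n, N)),
    E *m Gp + F1 *m F2 = 1%:M.
  apply: row_free_complement; first by rewrite subnK.
  by rewrite /row_free; apply/eqP.
pose S k l (A : 'M[C]_(k, l)) := map_mx sc A.
have vS k l (A : 'M[C]_(k, l)) i j : has_value (S k l A i j) (A i j).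
  by rewrite mxE; apply: value_const.
pose H := S _ _ E *m G + S _ _ F1 *m S _ _ F2.
have vH i j : has_value (H i j) ((1%:M : 'M[C]_N) i j).
  rewrite -EF [H i j]mxE [X in has_value _ X]mxE.
  apply: valueD; apply: value_mulmx => // {}i {}j.
  by rewrite !mxE; apply: value_poly.
have [Hu Hr] := regular_invmx vH (unitmx1 _ _).
have WH : W *m H^T = W *m (S _ _ F2)^T *m (S _ _ F1)^T.
  by rewrite /H linearD /= !trmx_mul mulmxDr mulmxA WG mul0mx add0r mulmxA.
pose V := W *m (S _ _ F2)^T.
have Vu : V \in unitmx.
  rewrite -row_free_unit -kermx_eq0; apply/eqP/row_matrixP => i; rewrite row0.
  apply: W0; have /sub_kermxP := row_sub i (kermx V); move: (row i _) => a aV.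
  have : a *m W *m H^T = 0 by rewrite -mulmxA WH !mulmxA -(mulmxA a) -/V aV mul0mx.
  by move/(congr1 (mulmx^~ (invmx H^T))); rewrite mulmxK ?unitmx_tr // mul0mx.
pose D i := vf_comb (invmx V i) d.
have Dx i j : D i (coord j) = (invmx V *m W) i j.
  by rewrite mxE; apply: eq_bigr => l _; rewrite mxE.
have DxE : invmx V *m W = (S _ _ F1)^T *m (invmx H)^T.
  rewrite -[LHS](mulmxK (_ : H^T \in unitmx)) ?unitmx_tr // -[_ *m W *m _]mulmxA WH -/V.
  by rewrite (mulmxA (invmx V)) mulVmx // mul1mx trmx_inv.
exists (fun k => \sum_j sc (F2 k j) * (coord j - sc (p j))), D; split.
- move=> k; apply/max_idealP.
  have -> : 0 = \sum_(j < N) F2 k j * (p j - p j).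
    by rewrite big1 // => j _; rewrite subrr mulr0.
  apply: value_sum => j; apply: valueM; first exact: value_const.
  by apply: valueB; [apply: value_coord | apply: value_const].
- move=> i; apply: preserves_regular_coord => j; rewrite Dx DxE mxE.
  apply: regular_at_sum => l; rewrite !mxE; apply: regular_atM; last exact: Hr.
  exact: value_regular (value_const _).
move=> i k; have derD := vf_derivation (D i).
have -> : (i == k)%:R = (1%:M : 'M[K]_n) i k by rewrite mxE.
rewrite -(mulVmx Vu) mulmxA [RHS]mxE (derivation_sum derD).
apply: eq_bigr => j _; rewrite (derivationM derD) (derivationB derD).
by rewrite !(derivationC derD) mul0r add0r subr0 Dx !mxE mulrC.
Qed.

(** The Jacobian matrix of any local coordinates z along the frame of smooth_frame is
    invertible at p: modulo the maximal ideal it is the inverse of the matrix that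
    expresses y in terms of z. *)
Lemma local_frame n (z : 'I_n -> K) : rational_of_dim P n -> smooth_of_dim P n ->
  local_coordinates p z ->
  exists D : 'I_n -> vector_field P,
    (forall i, preserves_regular (D i)) /\ forall i j, D i (z j) = (i == j)%:R.
Proof.
move=> rat smooth [z0 zgen].
have [y [d [y0 dr dy]]] := smooth_frame rat smooth.
have [a ha] := choice (fun k => zgen _ (y0 k)).
have zr j : regular_at p (z j) by apply/regular_atP; exists 0; apply/max_idealP.
have [ap vap] := choice (fun kl : 'I_n * 'I_n => (regular_atP _).1 ((ha kl.1).1 kl.2)).
have [bp vbp] := choice (fun il : 'I_n * 'I_n => (regular_atP _).1 (dr il.1 _ (zr il.2))).
pose Z := \matrix_(i, j) d i (z j); pose Zp := \matrix_(i, j) bp (i, j).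
pose Ap := \matrix_(j, k) ap (k, j).
have vZ i j : has_value (Z i j) (Zp i j) by rewrite !mxE; apply: (vbp (i, j)).
have Zpu : Zp \in unitmx.
  apply: (@proj1 _ (Ap \in unitmx)); apply: mulmx1_unit; apply/matrixP => i k.
  apply: (@value_unique (d i (y k))).
    have derd := vf_derivation (d i).
    rewrite (ha k).2 (derivation_sum derd) mxE; apply: value_sum => l.
    rewrite (derivationM derd) [Zp i l * _]mulrC -[X in has_value _ X]add0r.
    apply: valueD; last first.
      by rewrite !mxE; apply: valueM; [apply: (vap (k, l)) | apply: (vbp (i, l))].
    have [c dc] := (regular_atP _).1 (dr i _ ((ha k).1 l)).
    by rewrite -(mulr0 c); apply: valueM => //; apply/max_idealP.
  rewrite dy mxE; case: (i == k); [exact: value1 | exact: value0].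
have [Zu Zr] := regular_invmx vZ Zpu.
exists (fun i => vf_comb (invmx Z i) d); split=> [i|i j].
  exact: preserves_regular_comb.
transitivity ((invmx Z *m Z) i j); last by rewrite mulVmx // mxE.
by rewrite mxE; apply: eq_bigr => l _; rewrite mxE.
Qed.

End LocalRing.

(** * Leading forms *)

Section Homogeneous.
Variables (C : numFieldType) (n : nat).
Implicit Types (q : {mpoly C[n]}).

Lemma homog_mderiv d q i : q \is d.+1.-homog -> q^`M(i) \is d.-homog.
Proof.
move=> /dhomogP qd; apply/dhomogP => m; rewrite mcoeff_msupp mcoeff_mderiv => nz.
have /qd : (m + U_(i))%MM \in msupp q.
  by rewrite mcoeff_msupp; apply: contraNneq nz => ->; rewrite mul0rn.
by rewrite /= mdegD mdeg1 addn1 => -[].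
Qed.

Lemma homog0_const q : q \is 0.-homog -> q = (q@_0%MM)%:MP.
Proof.
move=> qd; apply/mpolyP => m; rewrite mcoeffC.
have [->|m0] := eqVneq m 0%MM; first by rewrite mulr1.
by rewrite mulr0; apply: (dhomog_nemf_coeff qd); rewrite /= mdeg_eq0.
Qed.

Lemma homog_size d q : q \is d.-homog -> (msize q <= d.+1)%N.
Proof.
move=> /dhomogP qd; rewrite msizeE; apply/bigmax_leqP_seq => m mq _.
by rewrite ltnS -(qd m mq).
Qed.

(** The bound N on the degrees of the enumerated monomials is free, so that sums over
    different degrees can be gathered in a single one. *)
Lemma mmap_homog_le (A : comNzRingType) (sc : {rmorphism C -> A}) (z : 'I_n -> A) N d q :
  q \is d.-homog -> (d < N)%N -> mmap sc z q =
  \sum_(m : 'X_{1..n < N} | mdeg m == d) sc q@_m * mmap1 z m.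
Proof.
move=> qd dN; rewrite (mmapE N) ?(leq_trans (homog_size qd)) // [RHS]big_mkcond.
apply: eq_bigr => m _; case: eqP => // /eqP md.
by rewrite (dhomog_nemf_coeff qd md) raddf0 mul0r.
Qed.

End Homogeneous.

Arguments max_ideal_pow : simpl never.

Section MaximalIdealPowers.
Variables (C : numFieldType) (P : variety C) (p : 'I_(ambient P) -> C).
Hypothesis Pp : pts p.
Local Notation K := (ratfun P).
Local Notation sc := (scal P).
Local Notation ev := (mmap (scal P)).
Local Notation pow := (max_ideal_pow p).

Lemma max_ideal_regular u : max_ideal p u -> regular_at p u.
Proof. by move/max_idealP; apply: value_regular. Qed.

Lemma max_idealZ r u : regular_at p r -> max_ideal p u -> max_ideal p (r * u).
Proof.
move=> /regular_atP [c rc] /max_idealP u0; apply/max_idealP; rewrite -(mulr0 c).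
exact: (valueM Pp).
Qed.

Lemma regular_at_const c : regular_at p (sc c).
Proof. exact: value_regular (value_const p c). Qed.

(** Stating the recursive case as a lemma keeps max_ideal_pow folded. *)
Lemma powSE d u : pow d.+1 u <->
  exists (k : nat) (a b : 'I_k -> K),
    [/\ forall i, max_ideal p (a i), forall i, pow d (b i)
      & u = \sum_(i < k) a i * b i].
Proof. by []. Qed.

Lemma powD d u v : pow d u -> pow d v -> pow d (u + v).
Proof.
case: d => [|d]; first exact: regular_atD.
move=> /powSE [k [a [b [ha hb ->]]]] /powSE [l [a' [b' [ha' hb' ->]]]]; exists (k + l)%N.
exists (fun i => match split i with inl j => a j | inr j => a' j end).
exists (fun i => match split i with inl j => b j | inr j => b' j end).
split=> [i|i|]; try by case: (split i).
rewrite big_split_ord /=; congr (_ + _); apply: eq_bigr => i _.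
  by rewrite (unsplitK (inl i)).
by rewrite (unsplitK (inr i)).
Qed.

Lemma powZ d r u : regular_at p r -> pow d u -> pow d (r * u).
Proof.
case: d => [|d] rr; first exact: regular_atM.
move=> /powSE [k [a [b [ha hb ->]]]]; exists k, (fun i => r * a i), b; split=> // [i|].
  exact: max_idealZ.
by rewrite mulr_sumr; apply: eq_bigr => i _; rewrite mulrA.
Qed.

Lemma powN d u : pow d u -> pow d (- u).
Proof.
move=> ud; rewrite -mulN1r; apply: powZ => //.
by have := regular_at_const (-1); rewrite rmorphN1.
Qed.

Lemma powB d u v : pow d u -> pow d v -> pow d (u - v).
Proof. by move=> ud vd; apply: powD => //; apply: powN. Qed.

Lemma pow0 d : pow d 0.
Proof.
case: d => [|d]; first by rewrite /= -(rmorph0 sc); apply: regular_at_const.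
by exists 0%N, (fun _ => 0), (fun _ => 0); split=> [[]|[]|] //; rewrite big_ord0.
Qed.

Lemma pow_sum d (I : Type) (r : seq I) (Q : pred I) (u : I -> K) :
  (forall i, Q i -> pow d (u i)) -> pow d (\sum_(i <- r | Q i) u i).
Proof.
by move=> ud; elim/big_rec: _ => [|i v Qi vd]; [apply: pow0 | apply: powD => //; apply: ud].
Qed.

Lemma powSM d u v : max_ideal p u -> pow d v -> pow d.+1 (u * v).
Proof.
by move=> um vd; exists 1%N, (fun _ => u), (fun _ => v); split=> //; rewrite big_ord1.
Qed.

Lemma powS_le d u : pow d.+1 u -> pow d u.
Proof.
elim: d u => [|d IHd] u /powSE [k [a [b [ha hb ->]]]]; apply: pow_sum => i _.
  by apply: regular_atM (hb i) => //; apply: max_ideal_regular.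
by apply: powSM => //; apply: IHd.
Qed.

Lemma pow_le d e u : (d <= e)%N -> pow e u -> pow d u.
Proof.
move=> /subnK <-; elim: (e - d)%N => [|k IHk]; first by rewrite add0n.
by rewrite addSn => /powS_le.
Qed.

Lemma powM d e u v : pow d u -> pow e v -> pow (d + e) (u * v).
Proof.
elim: d u => [|d IHd] u; first exact: powZ.
move=> /powSE [k [a [b [ha hb ->]]]] vd; rewrite mulr_suml; apply: pow_sum => i _.
by rewrite -mulrA addSn; apply: (powSM (ha i)); apply: IHd.
Qed.

Lemma pow1P u : pow 1 u <-> max_ideal p u.
Proof.
split=> [/powSE [k [a [b [ha hb ->]]]] | um].
  elim/big_rec: _ => [|i v _ /max_idealP v0]; first exact/max_idealP/value0.
  apply/max_idealP; rewrite -[0]addr0; apply: (valueD Pp) => //.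
  by apply/max_idealP; rewrite mulrC; exact: max_idealZ (hb i) (ha i).
rewrite -[u]mulr1; apply: powSM => //=.
exact: value_regular (value1 p).
Qed.

Lemma pow_prod (I : Type) (r : seq I) (Q : pred I) (d : I -> nat) (u : I -> K) :
  (forall i, pow (d i) (u i)) ->
  pow (\sum_(i <- r | Q i) d i) (\prod_(i <- r | Q i) u i).
Proof.
move=> ud; elim/big_rec2: _ => [|i v e _ ve]; last exact: powM.
exact: value_regular (value1 p).
Qed.

Lemma powX d e u : pow d u -> pow (e * d) (u ^+ e).
Proof.
move=> ud; elim: e => [|e IHe]; first exact: value_regular (value1 p).
by rewrite exprS mulSn; apply: powM.
Qed.

Lemma pow_deriv (D : vector_field P) d u :
  preserves_regular p D -> pow d.+1 u -> pow d (D u).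
Proof.
move=> Dr; have derD := vf_derivation D.
elim: d u => [|d IHd] u; first by move=> /powS_le; apply: Dr.
move=> /powSE [k [a [b [ha hb ->]]]]; rewrite (derivation_sum derD); apply: pow_sum => i _.
rewrite (derivationM derD); apply: powD.
  by apply: powZ => //; apply/Dr/max_ideal_regular.
by apply: powSM => //; apply: IHd.
Qed.

End MaximalIdealPowers.

Section LeadingForms.
Variables (C : numFieldType) (P : variety C) (p : 'I_(ambient P) -> C).
Hypothesis Pp : pts p.
Local Notation K := (ratfun P).
Local Notation sc := (scal P).
Local Notation ev := (mmap (scal P)).
Local Notation pow := (max_ideal_pow p).
Variables (n : nat) (z : 'I_n -> K) (D : 'I_n -> vector_field P).
Hypothesis zloc : local_coordinates p z.
Hypothesis Dreg : forall i, preserves_regular p (D i).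
Hypothesis Dz : forall i j, D i (z j) = (i == j)%:R.

(** The class of u in the d-th graded piece of the local ring, which is identified
    with the forms of degree d in the coordinates z.  The form q may be zero, in
    which case the order of u exceeds d; this makes lead d additive. *)
Definition lead (d : nat) (u : K) (q : {mpoly C[n]}) : Prop :=
  q \is d.-homog /\ pow d.+1 (u - ev z q).

Lemma deriv_coord i (q : {mpoly C[n]}) : D i (ev z q) = ev z q^`M(i).
Proof.
rewrite (derivation_mmap (vf_derivation (D i))) (bigD1 i) //= big1 => [|j ji].
  by rewrite Dz eqxx mulr1 addr0.
by rewrite Dz eq_sym (negPf ji) mulr0.
Qed.

Lemma pow_const c : pow 1 (sc c) -> c = 0.
Proof.
move/(pow1P Pp)/max_idealP; exact: (value_unique Pp (value_const p c)).
Qed.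

Lemma pow_mmap1 m : pow (mdeg m) (mmap1 z m).
Proof.
rewrite mdegE; apply: pow_prod => // i.
have := powX Pp (m i) ((pow1P Pp (z i)).2 (zloc.1 i)); by rewrite muln1.
Qed.

Lemma pow_homog d q : q \is d.-homog -> pow d (ev z q).
Proof.
move=> /dhomogP qd; rewrite /mmap big_seq; apply: pow_sum => // m mq.
apply: powZ => //; first exact: regular_at_const.
by rewrite -(qd m mq); apply: pow_mmap1.
Qed.

(** The graded ring is a polynomial ring: a relation in degree d + 1 is differentiated
    along the frame dual to z, down to degree 0. *)
Lemma homog_pow_eq0 d q : q \is d.-homog -> pow d.+1 (ev z q) -> q = 0.
Proof.
elim: d q => [|d IHd] q qd qpow.
  move: qpow; rewrite (homog0_const qd) mmapC => /pow_const ->.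
  by rewrite mpolyC0.
have dq i : q^`M(i) = 0.
  apply: IHd; first exact: homog_mderiv.
  by rewrite -deriv_coord; apply: pow_deriv.
rewrite [q](mderiv_eq0_const dq) (dhomog_nemf_coeff qd) ?mpolyC0 //.
by rewrite /= mdeg0.
Qed.

Lemma lead_unique d u q r : lead d u q -> lead d u r -> q = r.
Proof.
move=> [qd uq] [rd ur]; apply/eqP; rewrite -subr_eq0; apply/eqP.
apply: (@homog_pow_eq0 d); first by rewrite rpredB.
have -> : ev z (q - r) = (u - ev z r) - (u - ev z q) by rewrite rmorphB /=; ring.
exact: powB.
Qed.

Lemma lead_pow0 d u : pow d.+1 u -> lead d u 0.
Proof. by move=> ud; split; [exact: rpred0 | rewrite raddf0 subr0]. Qed.

Lemma lead_pow d u q : lead d u q -> pow d u.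
Proof.
case=> qd uq; rewrite -[u](subrK (ev z q)); apply: powD => //.
  exact: powS_le.
exact: pow_homog.
Qed.

Lemma leadD d u v q r : lead d u q -> lead d v r -> lead d (u + v) (q + r).
Proof.
move=> [qd uq] [rd vr]; split; first exact: rpredD.
by rewrite rmorphD /= opprD addrACA; apply: powD.
Qed.

Lemma lead_sum (I : Type) (s : seq I) (Q : pred I) d (u : I -> K) (q : I -> {mpoly C[n]}) :
  (forall i, lead d (u i) (q i)) ->
  lead d (\sum_(i <- s | Q i) u i) (\sum_(i <- s | Q i) q i).
Proof.
move=> uq; elim/big_rec2: _ => [|i r v _ vr]; last exact: leadD.
exact/lead_pow0/pow0.
Qed.

Lemma leadM d e u v q r : lead d u q -> lead e v r -> lead (d + e) (u * v) (q * r).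
Proof.
move=> uq vr; split; first by case: uq vr => qd _ [rd _]; apply: dhomogM.
have -> : u * v - ev z (q * r) = (u - ev z q) * v + ev z q * (v - ev z r).
  by rewrite rmorphM /=; ring.
apply: powD => //.
  by rewrite -addSn; apply: powM (lead_pow vr) => //; case: uq.
by rewrite -addnS; apply: powM => //; [apply: pow_homog; case: uq | case: vr].
Qed.

Lemma lead_const c : lead 0 (sc c) c%:MP.
Proof.
split.
  apply/dhomogP => m; rewrite msuppC; case: ifP => // _; rewrite inE => /eqP ->.
  exact: mdeg0.
by rewrite mmapC subrr; apply: pow0.
Qed.

Lemma lead_coord i : lead 1 (z i) 'X_i.
Proof.
by split; [rewrite dhomogX /= mdeg1 | rewrite mmapX mmap1U subrr; apply: pow0].
Qed.

Lemma lead_homog d q : q \is d.-homog -> lead d (ev z q) q.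
Proof. by move=> qd; split=> //; rewrite subrr; apply: pow0. Qed.

Lemma leadN d u q : lead d u q -> lead d (- u) (- q).
Proof.
move=> uq; rewrite -mulN1r -[- q]mulN1r.
have := leadM (lead_const (-1)) uq; rewrite add0n rmorphN1.
by rewrite mpolyCN mpolyC1.
Qed.

Lemma lead_prod (I : Type) (s : seq I) (Q : pred I) (d : I -> nat) (u : I -> K)
    (q : I -> {mpoly C[n]}) :
  (forall i, lead (d i) (u i) (q i)) ->
  lead (\sum_(i <- s | Q i) d i) (\prod_(i <- s | Q i) u i) (\prod_(i <- s | Q i) q i).
Proof.
move=> uq; elim/big_rec3: _ => [|i r v e _ h]; last exact: leadM.
by have := lead_const 1; rewrite rmorph1 mpolyC1.
Qed.

(** The coefficients of an element of the d-th power of the maximal ideal, written in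
    the generators z, may be replaced by their values at p. *)
Lemma lead_exists d u : pow d u -> exists q, lead d u q.
Proof.
elim: d u => [|d IHd] u.
  move=> /(regular_atP p) [c uc]; exists c%:MP; split; first by case: (lead_const c).
  rewrite mmapC; apply/(pow1P Pp)/max_idealP; rewrite -(subrr c).
  exact: (valueB Pp uc (value_const p c)).
have max_lead a : max_ideal p a -> exists q, lead 1 a q.
  move=> /zloc.2 [c [creg ->]].
  have [cv hcv] := choice (fun j => (regular_atP p (c j)).1 (creg j)).
  exists (\sum_j (cv j)%:MP * 'X_j); apply: lead_sum => j.
  rewrite -[1%N]add0n; apply: leadM (lead_coord j).
  split; first by case: (lead_const (cv j)).
  rewrite mmapC; apply/(pow1P Pp)/max_idealP; rewrite -(subrr (cv j)).
  exact: (valueB Pp (hcv j) (value_const p _)).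
move=> /powSE [k [a [b [ha hb ->]]]].
have [qa hqa] := choice (fun i => max_lead _ (ha i)).
have [qb hqb] := choice (fun i => IHd _ (hb i)).
by exists (\sum_i qa i * qb i); apply: lead_sum => i; rewrite -add1n; apply: leadM.
Qed.

Lemma lead_order d e u q : lead d u q -> q != 0 -> pow e u -> (e <= d)%N.
Proof.
move=> uq q0 ue; rewrite leqNgt; apply/negP => de; move/eqP: q0; apply.
exact: lead_unique uq (lead_pow0 (pow_le Pp de ue)).
Qed.

(** The property is inherited by all partial derivatives, which have smaller degree. *)
Lemma all_pow_poly_eq0 (a : {mpoly C[n]}) : (forall d, pow d (ev z a)) -> a = 0.
Proof.
have [N] := ubnP (msize a); elim: N a => // N IHN a le_a apow.
have da0 j : a^`M(j) = 0.
  have [->|a0] := eqVneq a 0; first by rewrite mderiv0.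
  apply: IHN; last by move=> d; rewrite -deriv_coord; apply: pow_deriv.
  rewrite ltnS in le_a; exact: leq_trans (msize_mderiv_lt _ _) le_a.
rewrite [a](mderiv_eq0_const da0) in apow *.
by have := apow 1%N; rewrite mmapC => /pow_const ->; rewrite mpolyC0.
Qed.

(** Krull's intersection theorem, without Noetherian arguments: u is algebraic over the
    coordinates z.  If u is not 0, a relation of minimal degree in u has a non-zero
    constant coefficient c(z), a multiple of u, which then lies in all powers of the
    maximal ideal; this contradicts all_pow_poly_eq0. *)
Lemma krull_intersection : rational_of_dim P n ->
  forall u, (forall d, pow d u) -> u = 0.
Proof.
move=> [t /transcendental_basisP [_ tgen]] u upow.
have [Q [Q0 Qu]] := algebraic_relation (fun i => tgen (z i)) (tgen u).
apply/eqP; apply: contraTT isT => u0; suff: False by [].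
have evr a : regular_at p (ev z a).
  elim/mpoly_alg_ind: a => [c|i|a b|a b].
  - rewrite mmapC; exact: regular_at_const.
  - by rewrite mmapX mmap1U; apply/max_ideal_regular/zloc.1.
  - by rewrite rmorphD; apply: regular_atD.
  by rewrite rmorphM; apply: regular_atM.
pose e (R : {poly {mpoly C[n]}}) := (map_poly (ev z) R).[u].
have eMXC R c : e (R * 'X + c%:P) = e R * u + ev z c.
  by rewrite /e rmorphD rmorphM /= map_polyX map_polyC hornerMXaddC.
have er R : regular_at p (e R).
  elim/poly_ind: R => [|R c IHR]; first by rewrite /e rmorph0 horner0; apply: (@pow0 _ _ p 0).
  by rewrite eMXC; apply: regular_atD => //; apply: regular_atM => //; apply: (upow 0%N).
elim/poly_ind: Q Q0 Qu => [|R c IHR]; first by rewrite eqxx.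
rewrite -/(e _) eMXC => nz Ru.
have c0 : c = 0.
  apply: all_pow_poly_eq0 => d; have -> : ev z c = - (e R * u).
    by apply/eqP; rewrite -addr_eq0 addrC Ru.
  by apply: powN => //; apply: powZ.
move: nz Ru; rewrite c0 addr0 raddf0 addr0 => nz /eqP.
rewrite mulf_eq0 (negPf u0) orbF => /eqP; apply: IHR.
by apply: contraNneq nz => ->; rewrite mul0r.
Qed.

Lemma lead_nonzero u : rational_of_dim P n -> regular_at p u -> u != 0 ->
  exists d q, lead d u q /\ q != 0.
Proof.
move=> rat ur u0; apply/not_existsP => no; move/eqP: u0; apply.
apply: krull_intersection => // d; elim: d => // d IHd.
have [q uq] := lead_exists IHd.
have [q0|q0] := eqVneq q 0; last by case: (no d); exists q.
by case: uq; rewrite q0 raddf0 subr0.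
Qed.

Lemma lowest_term_lead u d q : lowest_term p z u d q -> lead d u q /\ q != 0.
Proof.
case=> c [ct cd qE q0]; split=> //; split.
  by rewrite qE; apply: rpred_sum => m md; rewrite rpredZ // dhomogX.
have -> : ev z q = \sum_(m : 'X_{1..n < d.+1}) sc (c m) * mmap1 z m; last exact: ct.
rewrite qE raddf_sum /= [LHS]big_mkcond; apply: eq_bigr => m _.
case: eqP => [_|/eqP md]; first by rewrite mmapZ mmapX.
rewrite cd ?rmorph0 ?mul0r // ltn_neqAle md.
by have := bmdeg m; rewrite ltnS.
Qed.

(** The Taylor expansion is built degree by degree, subtracting from u the leading
    form of the successive remainders. *)
Lemma lead_lowest_term u d q : lead d u q -> q != 0 -> lowest_term p z u d q.
Proof.
move=> uq q0.
(* L selects a leading form, with a junk value outside the relevant power of the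
   maximal ideal. *)
have [L HL] : exists L : nat * K -> {mpoly C[n]},
    forall ev, pow ev.1 ev.2 -> lead ev.1 ev.2 (L ev).
  suff /choice [L HL] : forall ev : nat * K, exists q, pow ev.1 ev.2 -> lead ev.1 ev.2 q.
    by exists L.
  move=> [e v] /=; have [h|h] := EM (pow e v); last by exists 0.
  by have [r] := lead_exists h; exists r.
pose rem := fix rem e := if e is e'.+1 then rem e' - ev z (L (e', rem e')) else u.
have rem_pow e : pow e (rem e).
  elim: e => [|e IHe]; first exact: pow_le (lead_pow uq).
  by case: (HL (e, rem e) IHe).
have rem_lead e : lead e (rem e) (L (e, rem e)) := HL (e, rem e) (rem_pow e).
have rem_u e : (e <= d)%N -> rem e = u.
  elim: e => // e IHe ed; rewrite /= IHe ?(ltnW ed) //.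
  have := rem_lead e; rewrite IHe ?(ltnW ed) // => h.
  by rewrite (lead_unique h (lead_pow0 (pow_le Pp ed (lead_pow uq)))) raddf0 subr0.
pose c (m : 'X_{1..n}) := (L (mdeg m, rem (mdeg m)))@_m.
have Ld : L (d, u) = q.
  by have := rem_lead d; rewrite rem_u // => h; apply: lead_unique h uq.
exists c; split=> //.
- move=> e; suff <- : rem e.+1 = u - \sum_(m : 'X_{1..n < e.+1}) sc (c m) * mmap1 z m by [].
  have remE k : rem k = u - \sum_(i < k) ev z (L (i : nat, rem i)).
    elim: k => [|k IHk]; first by rewrite big_ord0 subr0.
    by rewrite big_ord_recr /= {1}IHk opprD addrA.
  rewrite remE; congr (_ - _).
  rewrite (partition_big (fun m : 'X_{1..n < e.+1} => Ordinal (bmdeg m)) xpredT) //=.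
  apply: eq_bigr => i _; rewrite (mmap_homog_le _ _ (rem_lead i).1 (ltn_ord i)).
  by apply: eq_big => m; [rewrite -val_eqE | move=> /eqP <-].
- move=> m md; rewrite /c rem_u ?(ltnW md) //.
  have := rem_lead (mdeg m); rewrite rem_u ?(ltnW md) // => h.
  by rewrite (lead_unique h (lead_pow0 (pow_le Pp md (lead_pow uq)))) mcoeff0.
rewrite [LHS](mpolywE (homog_size uq.1)) [RHS]big_mkcond; apply: eq_bigr => m _.
case: eqP => [md|/eqP md]; first by rewrite /c md rem_u // Ld.
by rewrite (dhomog_nemf_coeff uq.1) ?scale0r.
Qed.

End LeadingForms.

(** * Rank of matrices *)

Section Rank.
Variable (K : fieldType).

Lemma row_free_rowsub1 m n (f : 'I_m -> 'I_n) : injective f ->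
  row_free (rowsub f (1%:M : 'M[K]_n)).
Proof.
move=> f_inj; apply/row_freeP; exists (rowsub f 1%:M)^T.
apply/matrixP => i j; rewrite !mxE (bigD1 (f j)) //= big1 => [|l lj].
  by rewrite !mxE eqxx mulr1 addr0 (inj_eq f_inj).
by rewrite !mxE [f j == l]eq_sym (negPf lj) mulr0.
Qed.

(** Rows of an invertible matrix are independent, so A has rank at least #|J|. *)
Lemma det_agree_rows_eq0 n (A M : 'M[K]_n) (J : {set 'I_n}) :
  (forall j i, j \in J -> M j i = A j i) -> (\rank A < #|J|)%N -> \det M = 0.
Proof.
move=> MA; apply: contraTeq; rewrite -unitfE -unitmxE -leqNgt => Mu.
pose f (i : 'I_#|J|) : 'I_n := enum_val i.
have f_inj : injective f by apply: enum_val_inj.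
have fMA : rowsub f M = rowsub f A.
  by apply/matrixP => i j; rewrite !mxE MA // enum_valP.
have /eqP <- := row_free_rowsub1 f_inj.
rewrite -(mxrankMfree _ (_ : row_free M)) ?row_free_unit // -rowsubE fMA rowsubE.
exact: mxrankM_maxr.
Qed.

(** Independence is stated for families of coefficients indexed by all rows and
    supported on J, which avoids indexing by the elements of J. *)
Lemma independent_rows n m (A : 'M[K]_n) : (m <= \rank A)%N ->
  exists J : {set 'I_n}, #|J| = m /\
    forall b : 'I_n -> K, (forall j, j \notin J -> b j = 0) ->
      (forall l, \sum_j b j * A j l = 0) -> forall j, b j = 0.
Proof.
move=> mA; pose f := maxrankfun A; pose g i := f (widen_ord mA i).
have g_inj : injective g.
  by move=> i j /maxrankfun_inj /(congr1 val) /= /val_inj.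
exists [set g i | i : 'I_m]; split; first by rewrite card_imset // card_ord.
move=> b bJ bA; pose v := \row_t b (f t).
have vA : v *m rowsub f A = 0.
  apply/rowP => l; rewrite mxE [RHS]mxE -[RHS](bA l).
  rewrite (bigID (fun j => j \in f @: xpredT)) /= [X in _ + X]big1 ?addr0; last first.
    move=> j jf; rewrite bJ ?mul0r //; apply: contra jf => /imsetP [i _ ->].
    exact: imset_f.
  rewrite big_imset /=; last by move=> t s _ _ /maxrankfun_inj.
  by apply: eq_bigr => t _; rewrite !mxE.
have v0 : v = 0.
  by apply: (row_free_inj (maxrowsub_free A)); rewrite mul0mx.
move=> j; have [/imsetP [i _ ->]|/bJ //] := boolP (j \in [set g i | i : 'I_m]).
by have /rowP/(_ (widen_ord mA i)) := v0; rewrite !mxE.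
Qed.

End Rank.

(** * Leading forms of brackets and of Jacobian determinants *)

Lemma homog1_sum (C : numFieldType) n (q : {mpoly C[n]}) : q \is 1.-homog ->
  q = \sum_i q@_(U_(i)) *: 'X_i.
Proof.
move=> q1; apply/mpolyP => m; rewrite raddf_sum /=.
have [m1|m1] := boolP (mdeg m == 1%N); last first.
  rewrite (dhomog_nemf_coeff q1 m1) big1 // => i _; rewrite mcoeffZ mcoeffX.
  by case: eqP => [e|_]; [rewrite -e mdeg1 in m1 | rewrite mulr0].
have [i ->] : exists i, m = U_(i)%MM.
  by move: m1; rewrite mdeg_eq1 => /existsP [i /eqP ->]; exists i.
rewrite (bigD1 i) //= big1 => [|j ji]; first by rewrite mcoeffZ mcoeffX eqxx mulr1 addr0.
by rewrite mcoeffZ mcoeffX eq_mnm1 (negPf ji) mulr0.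
Qed.

Section LocalBracket.
Variables (C : numFieldType) (P : variety C) (p : 'I_(ambient P) -> C).
Hypothesis Pp : pts p.
Local Notation K := (ratfun P).
Local Notation sc := (scal P).
Local Notation ev := (mmap (scal P)).
Local Notation pow := (max_ideal_pow p).
Variables (n : nat) (z : 'I_n -> K) (D : 'I_n -> vector_field P).
Hypothesis zloc : local_coordinates p z.
Hypothesis Dreg : forall i, preserves_regular p (D i).
Hypothesis Dz : forall i j, D i (z j) = (i == j)%:R.
Variables (br : K -> K -> K) (br0 : {mpoly C[n]} -> {mpoly C[n]} -> {mpoly C[n]}).
Hypothesis brP : is_poisson_bracket sc br.
Hypothesis br_vanish : vanishes_at p br.
Hypothesis br0P : linearization p z br br0.
Local Notation lead := (lead p z).

Lemma bracket_derivl (A : comNzRingType) (s : {rmorphism C -> A}) (b : A -> A -> A) v :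
  is_poisson_bracket s b -> is_derivation s (b ^~ v).
Proof.
case=> bder bC _; split=> [x y|c|x y].
- by rewrite bC (derivationD (bder v)) opprD -!bC.
- by rewrite bC (derivationC (bder v)) oppr0.
by rewrite bC (derivationM (bder v)) opprD [b v x]bC [b v y]bC mulNr mulrN !opprK.
Qed.

(** Since the bracket vanishes at p, each Hamiltonian derivation maps the local ring
    to the maximal ideal, hence preserves the powers of the latter. *)
Lemma pow_bracket_regular d u v : pow d u -> regular_at p v -> pow d (br u v).
Proof.
move=> + vr; have derv := bracket_derivl v brP.
elim: d u => [|d IHd] u ud; first exact: max_ideal_regular (br_vanish ud vr).
case/powSE: ud => k [a [b [ha hb ->]]].
rewrite (derivation_sum derv); apply: pow_sum => // i _.
rewrite (derivationM derv); apply: powD => //; last first.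
  by apply: powSM => //; apply: IHd.
by apply: powSM => //; apply: br_vanish => //; apply: max_ideal_regular.
Qed.

(** Leibniz rule on v = a b with a in the maximal ideal: in the term (br u a) b the
    bracket stays in the d-th power, by the previous lemma, and a (br u b) is
    handled by induction. *)
Lemma pow_bracket d e u v : pow d u -> pow e.+1 v -> pow (d + e) (br u v).
Proof.
move=> ud; have deru := bracket_derivation u brP.
elim: e v => [|e IHe] v.
  by rewrite addn0 => v1; apply: pow_bracket_regular (powS_le Pp v1).
move=> /powSE [k [a [b [ha hb ->]]]].
rewrite (derivation_sum deru); apply: pow_sum => // i _.
rewrite (derivationM deru); apply: powD => //.
  by apply: powM => //; apply/pow_bracket_regular/max_ideal_regular.
by rewrite addnS; apply: powSM => //; apply: IHe.
Qed.

Lemma lead_differential u l : lead 1 u l -> differential p z u l.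
Proof.
move=> [l1 ul]; exists 0, (fun i => l@_(U_(i))); split; first exact: homog1_sum.
rewrite rmorph0 subr0; suff <- : ev z l = \sum_i sc l@_(U_(i)) * z i by [].
rewrite [l in LHS](homog1_sum l1) raddf_sum /=.
by apply: eq_bigr => i _; rewrite mmapZ mmapX mmap1U.
Qed.

Lemma coord_regular i : regular_at p (z i).
Proof. exact/max_ideal_regular/zloc.1. Qed.

Lemma lead_bracket_coord i j : lead 1 (br (z i) (z j)) (br0 'X_i 'X_j).
Proof.
have [l hl] : exists l, lead 1 (br (z i) (z j)) l.
  apply: (lead_exists Pp zloc); apply/pow1P => //.
  by apply: br_vanish; apply: coord_regular.
suff -> : br0 'X_i 'X_j = l by [].
have diffz k : differential p z (z k) 'X_k by apply/lead_differential/lead_coord.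
have [zi zj] := (coord_regular i, coord_regular j).
exact: br0P.2 _ _ _ _ _ zi zj (diffz i) (diffz j) (lead_differential hl).
Qed.

Lemma bracket_mmap (A : comNzRingType) (s : {rmorphism C -> A}) (b : A -> A -> A)
    (x : 'I_n -> A) (q r : {mpoly C[n]}) : is_poisson_bracket s b ->
  b (mmap s x q) (mmap s x r) =
  \sum_i \sum_j mmap s x q^`M(i) * mmap s x r^`M(j) * b (x i) (x j).
Proof.
move=> bP; rewrite (derivation_mmap (bracket_derivl _ bP)); apply: eq_bigr => i _.
rewrite (derivation_mmap (bracket_derivation _ bP)) mulr_sumr.
by apply: eq_bigr => j _; rewrite mulrA.
Qed.

(** The linearized bracket of leading forms is the leading form of the bracket: both are
    computed by the chain rule from the brackets of the coordinates, whose leading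
    forms define the linearization. *)
Lemma lead_bracket d e u v q r : lead d.+1 u q -> lead e.+1 v r ->
  lead (d + e).+1 (br u v) (br0 q r).
Proof.
move=> uq vr.
have main : lead (d + e).+1 (br (ev z q) (ev z r)) (br0 q r).
  rewrite bracket_mmap // -[q in br0 q _]mmap_id -[r in br0 _ r]mmap_id.
  rewrite (bracket_mmap _ _ _ br0P.1).
  apply: lead_sum => // i; apply: lead_sum => // j; rewrite !mmap_id -addn1.
  apply: (leadM Pp zloc); last exact: lead_bracket_coord.
  by apply: (leadM Pp zloc); apply: lead_homog => //; apply: homog_mderiv;
    [case: uq | case: vr].
rewrite -[br0 q r]addr0 -[br u v](subrK (br (ev z q) (ev z r))) addrC.
apply: leadD => //; apply: lead_pow0 => //.
have -> : br u v - br (ev z q) (ev z r) =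
    br (u - ev z q) (ev z r) + br u (v - ev z r).
  rewrite (derivationB (bracket_derivl _ brP)).
  rewrite (derivationB (bracket_derivation u brP)); ring.
apply: powD => //.
  have -> : (d + e).+2 = (d.+2 + e)%N by lia.
  by apply: pow_bracket; [case: uq | apply: (pow_homog Pp zloc); case: vr].
have -> : (d + e).+2 = (d.+1 + e.+1)%N by lia.
by apply: pow_bracket; [exact: (lead_pow Pp zloc uq) | case: vr].
Qed.

(** The bracket of u and v is a multiple of u v, of order d + e, while the bracket of
    their leading forms sits in degree d + e - 1. *)
Lemma lead_commute d e u v q r : log_pair br u v ->
  lead d u q -> lead e v r -> br0 q r = 0.
Proof.
move=> [l uv] uq vr.
case: d uq => [|d] uq.
  rewrite (homog0_const uq.1).
  exact: (derivationC (bracket_derivl _ br0P.1)).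
case: e vr => [|e] vr.
  rewrite (homog0_const vr.1).
  exact: (derivationC (bracket_derivation _ br0P.1)).
apply: (lead_unique Pp Dreg Dz (lead_bracket uq vr)); apply: lead_pow0 => //.
have -> : (d + e).+2 = (d.+1 + e.+1)%N by lia.
rewrite uv -mulrA; apply: powZ => //; first exact: regular_at_const.
by apply: powM => //; [exact: (lead_pow Pp zloc uq) | exact: (lead_pow Pp zloc vr)].
Qed.

(** Write d phi_j = d q_j + (terms of order one more) and expand the determinant by
    multilinearity.  The terms that use more than k of the d q_j vanish, k being the
    rank of these differentials; in every other term, at most k of the factors have
    order d_j - 1 and the others have order d_j. *)
Lemma det_pow (phi : 'I_n -> K) (d : 'I_n -> nat) (q : 'I_n -> {mpoly C[n]}) :
  (forall j, lead (d j) (phi j) (q j)) ->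
  pow (\sum_j d j - \rank (\matrix_(j, i) ev z (q j)^`M(i)))
    (wedge_d phi D).
Proof.
move=> phiq; set A := \matrix_(j, i) _.
pose B := \matrix_(j, i) D i (phi j - ev z (q j)).
have Apow j i : pow (d j).-1 (A j i).
  rewrite mxE; case: (d j) (phiq j) => [|e] [qe _].
    by rewrite (homog0_const qe) mderivC raddf0; apply: pow0.
  by apply: (pow_homog Pp zloc); apply: homog_mderiv.
have Bpow j i : pow (d j) (B j i).
  by rewrite mxE; apply: pow_deriv => //; case: (phiq j).
pose Mix (J : {set 'I_n}) := \matrix_(j, i) if j \in J then A j i else B j i.
have -> : wedge_d phi D = \sum_(J : {set 'I_n}) \det (Mix J).
  rewrite /wedge_d -det_tr /determinant exchange_big /=; apply: eq_bigr => s _.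
  rewrite -mulr_sumr; congr (_ * _).
  rewrite (eq_bigr (fun j => A j (s j) + B j (s j))) => [|j _]; last first.
    by rewrite !mxE (derivationB (vf_derivation _)) deriv_coord // addrC subrK.
  rewrite bigA_distr; apply: eq_big => [J|J _]; first by rewrite inE.
  by apply: eq_bigr => j _; rewrite [RHS]mxE.
apply: pow_sum => // J _.
have [lt|ge] := ltnP (\rank A) #|J|.
  rewrite (@det_agree_rows_eq0 _ _ A (Mix J) J) //; first exact: pow0.
  by move=> j i jJ; rewrite mxE jJ.
apply: (@pow_le _ _ _ Pp _ (\sum_j (if j \in J then (d j).-1 else d j))%N).
  rewrite leq_subLR; apply: leq_trans (leq_add ge (leqnn _)).
  rewrite -sum1_card [X in (_ <= X + _)%N]big_mkcond -big_split; apply: leq_sum => j _ /=.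
  by case: (j \in J) => //; case: (d j).
apply: pow_sum => // s _; apply: powZ => //; first exact: value_regular (value_sign Pp _).
by apply: pow_prod => // j; rewrite mxE; case: (j \in J).
Qed.

(** A relation between the q_j would be one between the functions q_j(z), which is
    excluded by the Jacobian criterion. *)
Lemma gradients_alg_indep (J : {set 'I_n}) (q : 'I_n -> {mpoly C[n]}) :
  (forall b : 'I_n -> K, (forall j, j \notin J -> b j = 0) ->
      (forall l, \sum_j b j * ev z (q j)^`M(l) = 0) -> forall j, b j = 0) ->
  alg_indep (@mpolyC n C) (fun j : {j : 'I_n | j \in J} => q (val j)).
Proof.
move=> ind r /(congr1 (ev z)); rewrite mmap_comp raddf0; move: r.
apply: free_of_differentials => a aD i.
pose b j := oapp (fun j' : {j : 'I_n | j \in J} => a (enum_rank j')) 0 (insub j).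
suff : b (val (enum_val i)) = 0 by rewrite /b valK /= enum_valK.
apply: ind => [j jJ|l]; first by rewrite /b insubN.
rewrite -[RHS](aD _ (vf_derivation (D l))).
rewrite (eq_bigr (fun j => ev z (q j)^`M(l) * b j)); last by move=> j _; rewrite mulrC.
rewrite sum_sig_insub (reindex (@enum_val _ xpredT)) /=; last first.
  by exists enum_rank => t _; [rewrite enum_valK | rewrite enum_rankK].
by apply: eq_bigr => t _; rewrite enum_valK deriv_coord // mulrC.
Qed.

End LocalBracket.

(** * Property I and integrable systems *)

Section PropertyI.
Variables (C : numFieldType) (P : variety C) (p : 'I_(ambient P) -> C).
Hypothesis Pp : pts p.
Local Notation K := (ratfun P).
Local Notation pow := (max_ideal_pow p).
Variables (n : nat) (z : 'I_n -> K).
Hypothesis zloc : local_coordinates p z.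
Hypothesis rat : rational_of_dim P n.
Hypothesis smooth : smooth_of_dim P n.

Lemma form_degree_half_sign (w w' : rat_form P n) r : equal_up_to_sign w w' ->
  form_degree_half p z w r -> form_degree_half p z w' r.
Proof.
have [D [Dreg Dz]] := local_frame Pp rat smooth zloc.
move=> ww' [e [[g [h [dg [dh [qg [qh [[gr hr] wE gl hl eE]]]]]]] er]].
exists e; split=> //; case: ww' => ww'.
  by exists g, h, dg, dh, qg, qh; split=> // d; rewrite -ww' wE.
exists (- g), h, dg, dh, (- qg), qh; split=> //.
- by split=> //; apply: regular_atN.
- by move=> d; rewrite !mulNr -wE ww' opprK.
have [gL qg0] := lowest_term_lead gl.
by apply: (lead_lowest_term Pp zloc Dreg Dz); [apply: leadN | rewrite oppr_eq0].
Qed.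

(** Write mu = (g / h) dz.  Then h det(d phi / dz) = g prod_j phi_j, and comparing
    orders by det_pow gives n - k <= n + deg g - deg h = r / 2, where k is the rank of
    the differentials of the leading forms; so n - r / 2 of these are independent. *)
Lemma property_I_integrable br br0 (phi : 'I_n -> K) r :
  poisson_structure br -> vanishes_at p br -> linearization p z br br0 ->
  (forall j, regular_at p (phi j)) -> (forall i j, log_pair br (phi i) (phi j)) ->
  (exists d, wedge_d phi d != 0) -> property_I p z r phi ->
  exists q : 'I_n -> {mpoly C[n]},
    (forall j, exists d, lowest_term p z (phi j) d (q j)) /\
    exists J : {set 'I_n},
      polynomial_integrable_system br0 r (fun j : {j : 'I_n | j \in J} => q (val j)).
Proof.
move=> [brP _] br_vanish br0P phir philog [d0 phid0] phiI.
have [D [Dreg Dz]] := local_frame Pp rat smooth zloc.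
have phi0 j : phi j != 0 := poly_free_neq0 j (wedge_poly_free phid0).
have [d h1] := choice (fun j => lead_nonzero Pp zloc Dreg Dz rat (phir j) (phi0 j)).
have [q h2] := choice h1.
have phiq j : lead p z (d j) (phi j) (q j) by case: (h2 j).
have q0 j : q j != 0 by case: (h2 j).
exists q; split.
  by move=> j; exists (d j); apply: lead_lowest_term (phiq j) (q0 j).
pose A := \matrix_(j, i) mmap (scal P) z (q j)^`M(i).
case: phiI => e [[g [h [dg [dh [qg [qh [[gr hr] wE gl hl eE]]]]]]] er].
have [gL qg0] := lowest_term_lead gl; have [hL qh0] := lowest_term_lead hl.
have hn0 : h != 0.
  apply: contraNneq qh0 => h0; rewrite h0 in hL.
  by rewrite (lead_unique Pp Dreg Dz hL (lead_pow0 _ (pow0 p dh.+1))).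
have eq_forms : wedge_d phi D * h = g * \prod_j phi j.
  have prod0 : \prod_j phi j != 0 by apply/prodf_neq0.
  have := wE D; rewrite /log_volume (wedge_dual Dz) mulr1 => /eqP.
  by rewrite eqr_div // => /eqP.
have rank_bound : (dh <= dg + \rank A)%N.
  have lead_rhs : lead p z (dg + \sum_j d j) (g * \prod_j phi j) (qg * \prod_j q j).
    by apply: (leadM Pp zloc) => //; apply: (lead_prod Pp zloc).
  have := lead_order Pp Dreg Dz lead_rhs.
  rewrite -eq_forms mulf_neq0 //; last exact/prodf_neq0.
  move=> /(_ _ isT (powM Pp (det_pow Pp zloc Dreg Dz phiq) (lead_pow Pp zloc hL))).
  rewrite -/A; lia.
have [|J [cardJ Jind]] := @independent_rows _ _ (n - r./2) A; first by lia.
exists J; split; first by rewrite card_sig.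
  apply: (gradients_alg_indep Dz) => b bJ bA; apply: Jind => // l.
  by rewrite -[RHS](bA l); apply: eq_bigr => j _; rewrite mxE.
move=> i j.
exact: (lead_commute Pp zloc Dreg Dz brP br_vanish br0P (philog _ _) (phiq _) (phiq _)).
Qed.

End PropertyI.

Theorem theoremB (R : realType) (P : variety (complex R)) (n : nat)
    (br : ratfun P -> ratfun P -> ratfun P) (ex : {set 'I_n})
    (CS : ('I_n -> ratfun P) -> Prop)
    (Froz FrozBar : {j : 'I_n | j \notin ex} -> ratfun P) :
  rational_of_dim P n -> smooth_of_dim P n -> poisson_structure br ->
  is_cluster_structure ex CS \/ is_generalized_cluster_structure ex CS ->
  regular_structure CS -> compatible_structure br CS ->
  are_frozen_variables CS Froz ->
  frozen_modification Froz FrozBar -> (forall j, regular (FrozBar j)) ->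
  poisson_compatible_modification br Froz FrozBar ->
  ((forall phi, CS phi -> log_canonical br (modify FrozBar phi)) /\
   (forall phi psi, CS phi -> CS psi ->
      equal_up_to_sign (log_volume (modify FrozBar phi))
                       (log_volume (modify FrozBar psi)))) /\
  (forall (p0 : 'I_(ambient P) -> complex R) (z : 'I_n -> ratfun P)
      (br0 : {mpoly (complex R)[n]} -> {mpoly (complex R)[n]} ->
             {mpoly (complex R)[n]}) (r : nat) (mu : rat_form P n),
    pts p0 -> vanishes_at p0 br -> local_coordinates p0 z ->
    linearization p0 z br br0 -> poisson_rank br0 r ->
    (exists phi0, CS phi0 /\
       equal_up_to_sign mu (log_volume (modify FrozBar phi0))) ->
    form_degree_half p0 z mu r ->
    forall phi, CS phi ->
      property_I p0 z r (modify FrozBar phi) /\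
      (exists q : 'I_n -> {mpoly (complex R)[n]},
         (forall j, exists d, lowest_term p0 z (modify FrozBar phi j) d (q j)) /\
         exists J : {set 'I_n},
           polynomial_integrable_system br0 r
             (fun j : {j : 'I_n | j \in J} => q (val j)))).
Proof.
move=> rat smooth brS clusters reg compat frozenCS mod bar_reg bar_compat.
have [nz vol wedge] := clusters_log_volume clusters.
have [kappa volE] := log_volume_modify mod.
have log_phi phi : CS phi -> forall i j,
    log_pair br (modify FrozBar phi i) (modify FrozBar phi j).
  move=> CSphi; apply: (modify_log_pair brS.1 (Froz := Froz)) => //.
    by move=> j; apply: frozenCS.
  by move=> i j; apply: compat.
have reg_phi phi : CS phi -> forall j, regular (modify FrozBar phi j).
  by move=> CSphi; apply: modify_ind => // j _; apply: reg.
have wedge_phi phi : CS phi -> exists D, wedge_d (modify FrozBar phi) D != 0.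
  move=> CSphi; have [D D0] := wedge _ CSphi; exists D.
  by apply: (wedge_modify_neq0 mod) => // j; apply: frozenCS.
have vol_phi phi psi : CS phi -> CS psi ->
    equal_up_to_sign (log_volume (modify FrozBar phi)) (log_volume (modify FrozBar psi)).
  move=> CSphi CSpsi.
  have volP f (CSf : CS f) := volE f (fun j => frozenCS f j CSf) (nz f CSf).
  by case: (vol _ _ CSphi CSpsi) => e; [left | right] => D; rewrite !volP // e ?mulrN.
split.
  split=> // phi CSphi.
  by split; [exact: reg_phi | exact: log_phi | exact: wedge_phi].
move=> p0 z br0 r mu Pp0 br_vanish zloc lin _ [phi0 [CSphi0 mu0]] mu_half phi CSphi.
have phiI : property_I p0 z r (modify FrozBar phi).
  apply: (form_degree_half_sign Pp0 zloc rat smooth) mu_half.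
  exact: equal_up_to_sign_trans mu0 (vol_phi _ _ CSphi0 CSphi).
split=> //; apply: (property_I_integrable Pp0 zloc rat smooth brS) => //.
- by move=> j; apply: reg_phi.
- exact: log_phi.
exact: wedge_phi.
Qed.
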